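(* Let $K$ be a field, $S=K[x_0,\ldots,x_n]$ with $x_0<x_1<\cdots<x_n$, and let $J\subseteq S$ be a strongly stable monomial ideal. The $J$-marked family is flat at the origin, i.e. the family over the $J$-marked scheme $\mathrm{Spec}(K[C]/\mathfrak A)$ given by $\big((K[C]/\mathfrak A)[x_0,\ldots,x_n]\big)/(\mathcal G)$ is flat at the point $C=0$ (the point corresponding to $J$). In particular, for every homogeneous ideal $I\subseteq S$ such that $\mathcal N(J)$ is a $K$-basis of $S/I$, one has $\mathrm{reg}(J)\ge \mathrm{reg}(I)$.
   Context: A term is a monomial $x^\alpha=x_0^{\alpha_0}\cdots x_n^{\alpha_n}$. A monomial ideal $J$ is strongly stable if for every term $x^\alpha\in J$ and all $0\le i<j\le n$ with $\alpha_i>0$, the term $x_j x^\alpha/x_i$ belongs to $J$. $B_J$ is the minimal set of monomial generators of $J$, $\mathcal N(J)$ is the set of terms not in $J$, $\mathcal N(J)_d$ the set of those of degree $d$, and $J_m$ is the degree-$m$ homogeneous part of $J$. $\mathrm{reg}$ denotes Castelnuovo-Mumford regularity of a homogeneous ideal. The $J$-marked family is the set of homogeneous ideals $I$ of $S$ such that $\mathcal N(J)$ is a $K$-basis of $S/I$. For every $x^\alpha\in B_J$ let $F_\alpha:=x^\alpha-\sum_{x^\gamma\in\mathcal N(J)_{|\alpha|}}C_{\alpha\gamma}x^\gamma$, where the $C_{\alpha\gamma}$ are new variables; $C$ is the set of all these variables and $\mathcal G=\{F_\alpha : x^\alpha\in B_J\}$. For each $m$, let $A_m$ be the matrix whose columns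 correspond to the terms of degree $m$ in $S$ and whose rows correspond to all the polynomials of degree $m$ (in the $x_i$) of the form $x^\delta F_\alpha$, the row containing the coefficients of these terms in that polynomial. $\mathfrak A$ is the ideal of $K[C]$ generated by the minors of order $\dim_K J_m+1$ of $A_m$, for all $m$. The $J$-marked scheme is the affine scheme defined by $\mathfrak A$; its $K$-points are identified with the ideals of the $J$-marked family, a point $c$ corresponding to the ideal generated by $\mathcal G$ specialized at $C=c$. *)

(* Defs.v *)
From HB Require Import structures.
From mathcomp Require Import all_boot all_order all_algebra.
From mathcomp Require Import finmap ring.
From mathcomp Require Import -(notations) monalg.
From mathcomp Require Import mpoly.
From mathcomp Require Import boolp constructive_ereal.

Set Implicit Arguments.
Unset Strict Implicit.
Unset Printing Implicit Defensive.

Import GRing.Theory Order.TTheory Num.Theory.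

Local Open Scope ring_scope.
Local Open Scope quotient_scope.

Section Ideals.
Variable R : comNzRingType.

Definition is_ideal (I : R -> Prop) : Prop :=
  [/\ I 0, forall x y, I x -> I y -> I (x + y)
    & forall a x, I x -> I (a * x)].

Definition ideal_gen (G : R -> Prop) (x : R) : Prop :=
  exists s : seq (R * R),
    (forall p, p \in s -> G p.2) /\ x = \sum_(p <- s) p.1 * p.2.

Definition is_prime_ideal (P : R -> Prop) : Prop :=
  [/\ is_ideal P, ~ P 1 & forall x y, P (x * y) -> P x \/ P y].

Lemma ideal_gen_is_ideal (G : R -> Prop) : is_ideal (ideal_gen G).
Proof.
split.
- by exists [::]; split=> //; rewrite big_nil.
- move=> x y [s [hs ->]] [t [ht ->]]; exists (s ++ t); split.
    by move=> p; rewrite mem_cat => /orP[/hs|/ht].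
  by rewrite big_cat.
- move=> a x [s [hs ->]]; exists [seq (a * p.1, p.2) | p <- s]; split.
    by move=> p /mapP[q /hs hq ->].
  by rewrite big_map mulr_sumr; apply: eq_bigr => p _; rewrite mulrA.
Qed.

Lemma mem_ideal_gen (G : R -> Prop) x : G x -> ideal_gen G x.
Proof.
move=> Gx; exists [:: (1, x)]; split; last by rewrite big_seq1 mul1r.
by move=> p; rewrite inE => /eqP ->.
Qed.

Lemma ideal_gen_min (G I : R -> Prop) :
  is_ideal I -> (forall x, G x -> I x) -> forall x, ideal_gen G x -> I x.
Proof.
case=> I0 ID IM GI x [s [hs ->]]; rewrite big_seq.
elim/big_ind: _ => // p ps; apply: IM; apply: GI; exact: hs.
Qed.

End Ideals.

Section IdealOpp.
Variables (R : comNzRingType) (I : R -> Prop) (hI : is_ideal I).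

Lemma is_idealN x : I x -> I (- x).
Proof. by case: hI => _ _ hM /hM h; rewrite -mulN1r. Qed.

Lemma is_idealB x y : I x -> I y -> I (x - y).
Proof. by case: hI => _ hD _ hx /is_idealN; apply: hD. Qed.

End IdealOpp.

Section QuotientRing.
Variables (R : comNzRingType) (I : R -> Prop).
Hypotheses (hI : is_ideal I) (I1 : ~ I 1).

Definition ideal_pred of is_ideal I & ~ I 1 : {pred R} := fun x => `[< I x >].

Fact ideal_pred_closed : idealr_closed (ideal_pred hI I1).
Proof.
case: (hI) => h0 hD hM; split.
- exact/asboolP.
- by apply/negP => /asboolP.
- by move=> a u v /asboolP hu /asboolP hv; apply/asboolP/hD => //; apply: hM.
Qed.

HB.instance Definition _ :=
  isIdealr.Build R (ideal_pred hI I1) ideal_pred_closed.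

Definition quotring : Type := {ideal_quot (ideal_pred hI I1)}.
HB.instance Definition _ := GRing.ComNzRing.on quotring.

Definition quotring_pi : R -> quotring := \pi.

Fact quotring_pi_zmod_morphism : zmod_morphism quotring_pi.
Proof. exact: pi_is_zmod_morphism. Qed.

Fact quotring_pi_monoid_morphism : monoid_morphism quotring_pi.
Proof. exact: pi_is_monoid_morphism. Qed.

HB.instance Definition _ := GRing.isZmodMorphism.Build R quotring quotring_pi
  quotring_pi_zmod_morphism.
HB.instance Definition _ := GRing.isMonoidMorphism.Build R quotring quotring_pi
  quotring_pi_monoid_morphism.

Lemma quotring_pi_eq x y : quotring_pi x = quotring_pi y <-> I (x - y).
Proof.
split=> [/eqP|h].
  by rewrite /quotring_pi -Quotient.idealrBE => /asboolP.
by apply/eqP; rewrite /quotring_pi -Quotient.idealrBE; apply/asboolP.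
Qed.

Lemma quotring_pi_surj a : exists x, a = quotring_pi x.
Proof. by exists (repr a); rewrite /quotring_pi reprK. Qed.

End QuotientRing.

Section QuotientModule.
Variables (A : comNzRingType) (V : lmodType A) (W : V -> Prop).

Definition is_submodule : Prop :=
  [/\ W 0, forall x y, W x -> W y -> W (x + y)
    & forall (a : A) x, W x -> W (a *: x)].

Hypothesis hW : is_submodule.

Definition submod_pred of is_submodule : {pred V} := fun v => `[< W v >].

Fact submod_pred_closed : GRing.submod_closed (submod_pred hW).
Proof.
case: (hW) => h0 hD hZ; split; first exact/asboolP.
by move=> a u v /asboolP hu /asboolP hv; apply/asboolP/hD => //; apply: hZ.
Qed.

HB.instance Definition _ := GRing.isSubmodClosed.Build A V (submod_pred hW)
  submod_pred_closed.

Definition quotmod : Type := Quotient.quot (submod_pred hW).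
HB.instance Definition _ := GRing.Zmodule.on quotmod.

Definition quotmod_pi : V -> quotmod := \pi.

Lemma quotmod_pi_eq x y : quotmod_pi x = quotmod_pi y <-> W (x - y).
Proof.
split=> [/eqP|h].
  by rewrite /quotmod_pi -Quotient.idealrBE => /asboolP.
by apply/eqP; rewrite /quotmod_pi -Quotient.idealrBE; apply/asboolP.
Qed.

Lemma quotmod_pi_surj a : exists x, a = quotmod_pi x.
Proof. by exists (repr a); rewrite /quotmod_pi reprK. Qed.

Fact quotmod_pi_zmod_morphism : zmod_morphism quotmod_pi.
Proof. exact: pi_is_zmod_morphism. Qed.

HB.instance Definition _ := GRing.isZmodMorphism.Build V quotmod quotmod_pi
  quotmod_pi_zmod_morphism.

Definition quotmod_scale (a : A) (x : quotmod) : quotmod :=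
  quotmod_pi (a *: repr x).

Lemma quotmod_pi_scale a v :
  quotmod_scale a (quotmod_pi v) = quotmod_pi (a *: v).
Proof.
case: (hW) => _ _ hZ; apply/quotmod_pi_eq; rewrite -scalerBr; apply: hZ.
by apply/quotmod_pi_eq; rewrite /quotmod_pi reprK.
Qed.

Fact quotmod_scaleA a b x :
  quotmod_scale a (quotmod_scale b x) = quotmod_scale (a * b) x.
Proof. by have [v ->] := quotmod_pi_surj x; rewrite !quotmod_pi_scale scalerA. Qed.

Fact quotmod_scale1 : left_id 1 quotmod_scale.
Proof.
by move=> x; have [v ->] := quotmod_pi_surj x; rewrite quotmod_pi_scale scale1r.
Qed.

Fact quotmod_scaleDr : right_distributive quotmod_scale +%R.
Proof.
move=> a x y; have [v ->] := quotmod_pi_surj x.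
have [w ->] := quotmod_pi_surj y.
by rewrite -raddfD !quotmod_pi_scale scalerDr raddfD.
Qed.

Fact quotmod_scaleDl x : {morph quotmod_scale^~ x : a b / a + b}.
Proof.
move=> a b; have [v ->] := quotmod_pi_surj x.
by rewrite !quotmod_pi_scale scalerDl raddfD.
Qed.

HB.instance Definition _ := GRing.Zmodule_isLmodule.Build A quotmod
  quotmod_scaleA quotmod_scale1 quotmod_scaleDr quotmod_scaleDl.

Fact quotmod_pi_scalable : scalable quotmod_pi.
Proof. by move=> a v; rewrite -quotmod_pi_scale. Qed.

HB.instance Definition _ := GRing.isScalable.Build A V quotmod *:%R quotmod_pi
  quotmod_pi_scalable.

End QuotientModule.

Section Localization.
Variables (A : comNzRingType) (P : A -> Prop) (hP : is_prime_ideal P).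

Definition denom : Type := {s : A | ~~ `[< P s >]}.
HB.instance Definition _ := Choice.on denom.

Definition den (s : denom) : A := sval s.

Lemma denP (s : denom) : ~ P (den s).
Proof. exact/asboolPn/(svalP s). Qed.

Fact denom1_subproof : ~~ `[< P 1 >].
Proof. by apply/asboolPn; case: hP. Qed.
Definition denom1 : denom := exist _ 1 denom1_subproof.

Fact denomM_subproof (s t : denom) : ~~ `[< P (den s * den t) >].
Proof.
by case: hP => _ _ h; apply/asboolPn => /h[]; apply: denP.
Qed.
Definition denomM (s t : denom) : denom :=
  exist (fun a => ~~ `[< P a >]) _ (denomM_subproof s t).

Lemma den1 : den denom1 = 1. Proof. by []. Qed.
Lemma denM s t : den (denomM s t) = den s * den t. Proof. by []. Qed.

Section FractionModule.
Variable V : lmodType A.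

Definition frac_eq (x y : V * denom) : bool :=
  `[< exists u : denom,
        (den u * den y.2) *: x.1 = (den u * den x.2) *: y.1 >].

Fact frac_eq_equiv : equiv_class_of frac_eq.
Proof.
split.
- by move=> x; apply/asboolP; exists denom1.
- move=> x y; apply/asboolP/asboolP => -[u hu]; by exists u.
- move=> y x z /asboolP[u hu] /asboolP[w hw]; apply/asboolP.
  exists (denomM (denomM u w) y.2); rewrite !denM.
  have -> : den u * den w * den y.2 * den z.2 =
     (den w * den z.2) * (den u * den y.2) by ring.
  rewrite -scalerA hu scalerA.
  have -> : den w * den z.2 * (den u * den x.2) =
     (den u * den x.2) * (den w * den z.2) by ring.
  rewrite -scalerA hw scalerA; congr (_ *: _); ring.
Qed.

Canonical frac_equiv := EquivRelPack frac_eq_equiv.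
Canonical frac_encModRel := defaultEncModRel frac_eq.

Definition locmod : Type := {eq_quot frac_eq}.
HB.instance Definition _ := Choice.on locmod.
HB.instance Definition _ := EqQuotient.on locmod.

Definition frac (v : V) (s : denom) : locmod := \pi_locmod (v, s).

Lemma frac_eqP v s w t :
  frac v s = frac w t <->
  exists u : denom, (den u * den t) *: v = (den u * den s) *: w.
Proof.
rewrite /frac; split=> [/eqP|h]; first by rewrite piE => /asboolP.
by apply/eqP; rewrite piE; apply/asboolP.
Qed.

Lemma frac_surj x : exists v s, x = frac v s.
Proof.
by exists (repr x).1, (repr x).2; rewrite /frac -surjective_pairing reprK.
Qed.

Lemma fracE v s w t : den t *: v = den s *: w -> frac v s = frac w t.
Proof. by move=> h; apply/frac_eqP; exists denom1; rewrite !den1 !mul1r. Qed.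

Definition locmod_zero : locmod := frac 0 denom1.
Definition locmod_opp (x : locmod) : locmod := frac (- (repr x).1) (repr x).2.
Definition locmod_add (x y : locmod) : locmod :=
  frac (den (repr y).2 *: (repr x).1 + den (repr x).2 *: (repr y).1)
       (denomM (repr x).2 (repr y).2).

Lemma frac_repr v s :
  exists u : denom, (den u * den s) *: (repr (frac v s)).1
                    = (den u * den (repr (frac v s)).2) *: v.
Proof. by apply/frac_eqP; rewrite /frac -surjective_pairing reprK. Qed.

Lemma frac_opp v s : locmod_opp (frac v s) = frac (- v) s.
Proof.
have [u hu] := frac_repr v s; apply/frac_eqP; exists u.
by rewrite !scalerN hu.
Qed.

Lemma frac_add v s w t :
  locmod_add (frac v s) (frac w t) =
  frac (den t *: v + den s *: w) (denomM s t).
Proof.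
have [u hu] := frac_repr v s; have [z hz] := frac_repr w t.
rewrite /locmod_add; move: (repr _) hu => [v' s'] /= hu.
move: (repr _) hz => [w' t'] /= hz.
apply/frac_eqP; exists (denomM u z); rewrite !denM.
rewrite !scalerDr !scalerA; congr (_ + _).
  have -> : den u * den z * (den s * den t) * den t' =
    (den z * den t * den t') * (den u * den s) by ring.
  by rewrite -scalerA hu scalerA; congr (_ *: _); ring.
have -> : den u * den z * (den s * den t) * den s' =
  (den u * den s * den s') * (den z * den t) by ring.
by rewrite -scalerA hz scalerA; congr (_ *: _); ring.
Qed.

Fact locmod_addA : associative locmod_add.
Proof.
move=> x y z; have [v [s ->]] := frac_surj x; have [w [t ->]] := frac_surj y.
have [a [r ->]] := frac_surj z; rewrite !frac_add; apply: fracE; rewrite ?denM ?den1.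
rewrite !scalerDr !scalerA !addrA.
by congr (_ + _ + _); congr (_ *: _); ring.
Qed.

Fact locmod_addC : commutative locmod_add.
Proof.
move=> x y; have [v [s ->]] := frac_surj x; have [w [t ->]] := frac_surj y.
by rewrite !frac_add; apply: fracE; rewrite ?denM ?den1 addrC mulrC.
Qed.

Fact locmod_add0 : left_id locmod_zero locmod_add.
Proof.
move=> x; have [v [s ->]] := frac_surj x; rewrite frac_add; apply: fracE; rewrite ?denM ?den1.
by rewrite scaler0 add0r !scale1r mul1r.
Qed.

Fact locmod_addN : left_inverse locmod_zero locmod_opp locmod_add.
Proof.
move=> x; have [v [s ->]] := frac_surj x; rewrite frac_opp frac_add.
by apply: fracE; rewrite ?denM ?den1 scalerN addNr !scaler0.
Qed.

HB.instance Definition _ := GRing.isZmodule.Build locmod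
  locmod_addA locmod_addC locmod_add0 locmod_addN.

Lemma fracD v s w t :
  frac v s + frac w t = frac (den t *: v + den s *: w) (denomM s t).
Proof. exact: frac_add. Qed.

End FractionModule.

Definition locring : Type := locmod A^o.
HB.instance Definition _ := GRing.Zmodule.on locring.

Definition rfrac (a : A) (s : denom) : locring := frac (a : A^o) s.

Lemma rfrac_surj (x : locring) : exists a s, x = rfrac a s.
Proof. exact: (@frac_surj A^o). Qed.

Lemma rfracD a s b t :
  rfrac a s + rfrac b t = rfrac (den t * a + den s * b) (denomM s t).
Proof. exact: (@fracD A^o). Qed.

Lemma rfrac_eqP a s b t :
  rfrac a s = rfrac b t <->
  exists u : denom, (den u * den t) * a = (den u * den s) * b.
Proof. exact: (@frac_eqP A^o). Qed.

Lemma rfracE a s b t : den t * a = den s * b -> rfrac a s = rfrac b t.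
Proof. exact: (@fracE A^o). Qed.

Section Action.
Variable V : lmodType A.

Definition loc_act (a : locring) (x : locmod V) : locmod V :=
  frac (((repr a).1 : A) *: (repr x).1) (denomM (repr a).2 (repr x).2).

Lemma frac_act (a : A) s (v : V) t :
  loc_act (rfrac a s) (frac v t) = frac (a *: v) (denomM s t).
Proof.
have [u hu] := frac_repr (a : A^o) s; have [z hz] := frac_repr v t.
rewrite /loc_act; move: (repr _) hu => [a' s'] /= hu.
move: (repr _) hz => [v' t'] /= hz.
pose b : A := a'; have {}hu : den u * den s * b = den u * den s' * a := hu.
rewrite -[a']/b; move: b hu => {a'} a' hu.
apply/frac_eqP; exists (denomM u z); rewrite !denM !scalerA.
have -> : den u * den z * (den s * den t) * a' =
  (den u * den s * a') * (den z * den t) by ring.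
rewrite -scalerA hz hu scalerA; congr (_ *: _); ring.
Qed.

Fact loc_actDr : right_distributive loc_act +%R.
Proof.
move=> x y z; have [a [s ->]] := rfrac_surj x; have [w [t ->]] := frac_surj y.
have [v [r ->]] := frac_surj z; rewrite fracD !frac_act fracD.
apply: fracE; rewrite ?denM !scalerDr !scalerA.
by congr (_ + _); congr (_ *: _); ring.
Qed.

Fact loc_actDl x : {morph loc_act^~ x : a b / a + b}.
Proof.
move=> a b; have [v [r ->]] := frac_surj x; have [c [s ->]] := rfrac_surj a.
have [d [t ->]] := rfrac_surj b; rewrite rfracD !frac_act fracD.
apply: fracE; rewrite !denM !scalerDr !scalerA -!scalerDl.
by congr (_ *: _); ring.
Qed.

End Action.

Section RingStructure.

Definition loc_one : locring := rfrac 1 denom1.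
Definition loc_mul (a b : locring) : locring := loc_act a b.

Lemma rfrac_mul a s b t :
  loc_mul (rfrac a s) (rfrac b t) = rfrac (a * b) (denomM s t).
Proof. exact: (@frac_act A^o). Qed.

Fact loc_actA (V : lmodType A) (a b : locring) (x : locmod V) :
  loc_act a (loc_act b x) = loc_act (loc_mul a b) x.
Proof.
have [v [r ->]] := frac_surj x; have [c [s ->]] := rfrac_surj a.
have [d [t ->]] := rfrac_surj b; rewrite rfrac_mul !frac_act.
by apply: fracE; rewrite !denM !scalerA; congr (_ *: _); ring.
Qed.

Fact loc_act1 (V : lmodType A) : left_id loc_one (@loc_act V).
Proof.
move=> x; have [v [r ->]] := frac_surj x; rewrite frac_act.
by apply: fracE; rewrite denM den1 mul1r scale1r.
Qed.

Fact loc_mulA : associative loc_mul.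
Proof. by move=> a b c; rewrite /loc_mul loc_actA. Qed.

Fact loc_mulC : commutative loc_mul.
Proof.
move=> a b; have [c [s ->]] := rfrac_surj a; have [d [t ->]] := rfrac_surj b.
by rewrite !rfrac_mul; apply: rfracE; rewrite !denM; ring.
Qed.

Fact loc_mul1 : left_id loc_one loc_mul.
Proof. exact: loc_act1. Qed.

Fact loc_mulDl : left_distributive loc_mul +%R.
Proof. by move=> a b c; rewrite /loc_mul loc_actDl. Qed.

HB.instance Definition _ := GRing.Zmodule_isComPzRing.Build locring
  loc_mulA loc_mulC loc_mul1 loc_mulDl.

End RingStructure.

HB.instance Definition _ (V : lmodType A) :=
  GRing.Zmodule_isLmodule.Build locring (locmod V)
    (@loc_actA V) (@loc_act1 V) (@loc_actDr V) (@loc_actDl V).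

Lemma fracZ (V : lmodType A) (a : A) s (v : V) t :
  rfrac a s *: frac v t = frac (a *: v) (denomM s t).
Proof. exact: frac_act. Qed.

Lemma rfracM (a b : A) s t :
  rfrac a s * rfrac b t = rfrac (a * b) (denomM s t).
Proof. exact: rfrac_mul. Qed.

End Localization.

Section Flatness.
Variable R : comPzRingType.

(* An element of N (x)_R M is represented by the list of the pure tensors of
   which it is the sum; [tensor_eq s t] says that the lists s and t represent
   the same element.  Since (- x) (x) y is an opposite of x (x) y, this
   presentation as a commutative monoid is also the presentation of the tensor
   product as an abelian group. *)
Inductive tensor_eq (N M : lmodType R) : seq (N * M) -> seq (N * M) -> Prop :=
| TensorRefl s : tensor_eq s s
| TensorSym s t : tensor_eq s t -> tensor_eq t s
| TensorTrans s t u : tensor_eq s t -> tensor_eq t u -> tensor_eq s u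
| TensorCat s s' t t' :
    tensor_eq s s' -> tensor_eq t t' -> tensor_eq (s ++ t) (s' ++ t')
| TensorC s t : tensor_eq (s ++ t) (t ++ s)
| Tensor0 y : tensor_eq [:: (0, y)] [::]
| TensorDl x x' y : tensor_eq [:: (x + x', y)] [:: (x, y); (x', y)]
| TensorDr x y y' : tensor_eq [:: (x, y + y')] [:: (x, y); (x, y')]
| TensorZ (a : R) x y : tensor_eq [:: (a *: x, y)] [:: (x, a *: y)].

Definition tensor_map (N N' M : lmodType R) (f : N -> N') :
  seq (N * M) -> seq (N' * M) := map (fun p => (f p.1, p.2)).

(* f (x) id_M is injective for every injective f. *)
Definition flat (M : lmodType R) : Prop :=
  forall (N N' : lmodType R) (f : {linear N -> N'}), injective f ->
  forall s t : seq (N * M),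
    tensor_eq (tensor_map f s) (tensor_map f t) -> tensor_eq s t.

End Flatness.

Definition flat_at (A : comNzRingType) (P : A -> Prop) (hP : is_prime_ideal P)
    (V : lmodType A) : Prop :=
  @flat (locring hP) (locmod hP V).

Section MonomialIdeals.
Variables (K : fieldType) (n : nat).
Local Notation S := {mpoly K[n.+1]}.
Local Notation M := 'X_{1..n.+1}.
Implicit Types (J I : S -> Prop) (a b c : M).

Definition is_monomial_ideal J : Prop :=
  exists T : M -> Prop,
    forall f, J f <-> ideal_gen (fun g => exists2 a, T a & g = 'X_[a]) f.

Definition is_strongly_stable J : Prop :=
  is_monomial_ideal J /\
  forall a (i j : 'I_n.+1), J 'X_[a] -> (i < j)%N -> (0 < a i)%N ->
    J 'X_[(a - U_(i) + U_(j))%MM].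

(* Terms are represented by their exponents. *)
Definition term_in J : pred M := fun a => `[< J 'X_[a] >].

(* B_J: the terms of J that are minimal for divisibility *)
Definition min_gen J : pred M := fun a =>
  term_in J a && `[< forall b, J 'X_[b] -> (b <= a)%MM -> b = a >].

(* The classes of the terms of N(J) form a K-basis of S/I: a linear combination
   of terms of N(J) is a polynomial supported in N(J). *)
Definition is_basis_mod J I : Prop :=
  (forall g, {in msupp g, forall a, ~~ term_in J a} -> I g -> g = 0) /\
  (forall f, exists2 g : S,
     {in msupp g, forall a, ~~ term_in J a} & I (f - g)).

Definition is_homogeneous_ideal I : Prop :=
  is_ideal I /\ forall f d, I f -> I (pihomog mdeg d f).

End MonomialIdeals.

Section MarkedScheme.
Variables (K : fieldType) (n : nat) (J : {mpoly K[n.+1]} -> Prop).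
Local Notation M := 'X_{1..n.+1}.

(* The pairs (alpha, gamma) indexing the variables C *)
Definition is_cvar : pred (M * M) := fun p =>
  [&& min_gen J p.1, ~~ term_in J p.2 & mdeg p.2 == mdeg p.1].
Definition cvar : Type := {p : M * M | is_cvar p}.
HB.instance Definition _ := Choice.on cvar.

(* K[C], as a monoid algebra since the type [cvar] of the variables is not
   given as an ordinal *)
Definition KC : Type := malg (cmonom cvar) K.
HB.instance Definition _ := GRing.ComNzRing.on KC.

Definition KCvar (c : cvar) : KC := mkmalgU (ucm c) 1.

(* C_(a,g), with the junk value 0 if (a, g) is not the index of a variable *)
Definition Ccoef (a g : M) : KC := oapp KCvar 0 (insub (a, g)).

Definition marked_poly (a : M) : {mpoly KC[n.+1]} :=
  'X_[a] - \sum_(g : 'X_{1..n.+1 < (mdeg a).+1} |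
                 (mdeg g == mdeg a) && ~~ term_in J g) Ccoef a g *: 'X_[g].

Definition terms (m : nat) : seq M :=
  [seq val x | x in [pred x : 'X_{1..n.+1 < m.+1} | mdeg x == m]].

Definition row_indices (m : nat) : seq (M * M) :=
  [seq (val x.1, val x.2) |
     x in [pred x : 'X_{1..n.+1 < m.+1} * 'X_{1..n.+1 < m.+1} |
             min_gen J (val x.2) && (mdeg x.1 + mdeg x.2 == m)%N]].

Definition marked_mx (m : nat) : 'M[KC]_(size (row_indices m), size (terms m)) :=
  \matrix_(i, j)
    let r := nth (0%MM, 0%MM) (row_indices m) i in
    ('X_[r.1] * marked_poly r.2)@_(nth 0%MM (terms m) j).

(* dim_K J_m, the terms of degree m in J being a basis of J_m *)
Definition dim_part (m : nat) : nat := count (term_in J) (terms m).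

(* Allowing repeated or unordered rows and columns only adds zero and the
   opposites of minors. *)
Definition is_minor (x : KC) : Prop :=
  exists (m : nat) (f : 'I_(dim_part m).+1 -> 'I_(size (row_indices m)))
         (g : 'I_(dim_part m).+1 -> 'I_(size (terms m))),
    x = \det (mxsub f g (marked_mx m)).

Definition minors_ideal : KC -> Prop := ideal_gen is_minor.

Definition KC_eval0 : KC -> K := @monalg.mcoeff (cmonom cvar) K monalg.one.
HB.instance Definition _ := GRing.RMorphism.on KC_eval0.

Lemma KC_eval0_var c : KC_eval0 (KCvar c) = 0.
Proof. by rewrite /KC_eval0 /KCvar mcoeffU cm1_eq1. Qed.


Lemma KC_eval0_marked_poly a :
  map_mpoly (@KC_eval0) (marked_poly a) = 'X_[a].
Proof.
rewrite /marked_poly rmorphB /= map_mpolyX rmorph_sum big1 ?subr0 //= => g _.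
rewrite map_mpolyZ /Ccoef; case: insub => [c|] /=.
  by rewrite KC_eval0_var scale0r.
by rewrite rmorph0 scale0r.
Qed.

End MarkedScheme.
Arguments KC_eval0 {K n J}.

Lemma malgUM (R : comNzRingType) (I : choiceType) (a b : R) (k l : cmonom I) :
  mkmalgU k a * mkmalgU l b = mkmalgU (mulcm k l) (a * b).
Proof. by rewrite [LHS]malgM_def fgmulUU. Qed.

Section Origin.
Variables (K : fieldType) (n : nat) (J : {mpoly K[n.+1]} -> Prop).
Hypothesis hJ : is_strongly_stable J.
Local Notation M := 'X_{1..n.+1}.
Local Notation KC := (KC J).

Lemma monomial_ideal_is_ideal : is_ideal J.
Proof.
have [T hT] := hJ.1; have [h0 hD hM] := @ideal_gen_is_ideal _
  (fun g : {mpoly K[n.+1]} => exists2 a, T a & g = 'X_[a]).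
by split=> [|x y /hT hx /hT hy|a x /hT hx]; apply/hT; auto.
Qed.

Lemma mem_terms m (a : M) : (a \in terms n m) = (mdeg a == m).
Proof.
apply/imageP/idP => [[x hx ->]|ha]; first by move: hx; rewrite inE.
have h : (mdeg a < m.+1)%N by rewrite (eqP ha).
by exists (BMultinom h); rewrite ?inE.
Qed.

Lemma uniq_terms m : uniq (terms n m).
Proof. by rewrite map_inj_uniq ?enum_uniq //; apply: val_inj. Qed.

Lemma minor_eval0 x : is_minor x -> KC_eval0 (J := J) x = 0.
Proof.
case=> m [f [g ->]]; rewrite -det_map_mx.
set B := map_mx _ _.
have hB i j : B i j = (nth 0%MM (terms n m) (g j) ==
    ((nth (0%MM, 0%MM) (row_indices J m) (f i)).1 +
    (nth (0%MM, 0%MM) (row_indices J m) (f i)).2)%MM)%:R.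
  rewrite !mxE /= -mcoeff_map_mpoly rmorphM /= map_mpolyX.
  by rewrite KC_eval0_marked_poly -mpolyXD mcoeffX eq_sym.
pose t j := nth 0%MM (terms n m) (g j).
have [/forallP hall|] := boolP [forall j, term_in J (t j)]; last first.
  rewrite negb_forall => /existsP[j hj].
  rewrite (expand_det_col _ j) big1 // => i _; rewrite hB.
  case: eqP => [ht|_]; last by rewrite mul0r.
  case/negP: hj; apply/asboolP; rewrite /t ht mpolyXD.
  have [_ _ hM] := monomial_ideal_is_ideal; apply: hM.
  have := mem_nth (0%MM, 0%MM) (ltn_ord (f i)).
  by case/imageP => y; rewrite inE => /andP[/andP[/asboolP h _] _] ->.
have [/injectiveP ti|/injectivePn[j1 [j2 hne he]]] := boolP (injectiveb t).
  have : (#|'I_(dim_part J m).+1| <= dim_part J m)%N.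
    rewrite cardE -(size_map t); apply: leq_trans (_ : size (filter (term_in J)
      (terms n m)) <= _)%N; last by rewrite size_filter.
    apply: uniq_leq_size; first by rewrite map_inj_uniq ?enum_uniq.
    move=> _ /mapP[j _ ->]; rewrite mem_filter hall /=.
    exact: mem_nth.
  by rewrite card_ord ltnn.
rewrite -det_tr; apply: (determinant_alternate hne) => i.
by rewrite [LHS]mxE [RHS]mxE !hB -!/(t _) he.
Qed.

Lemma minors_ideal_eval0 x : minors_ideal x -> KC_eval0 (J := J) x = 0.
Proof.
apply: (@ideal_gen_min _ _ (fun x => KC_eval0 x = 0)); last exact: minor_eval0.
split=> [|y z hy hz|a y hy]; first exact: rmorph0.
  by rewrite rmorphD /= hy hz addr0.
by rewrite rmorphM /= hy mulr0.
Qed.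

Fact minors_ideal_proper : ~ minors_ideal (1 : KC).
Proof. by move/minors_ideal_eval0; rewrite rmorph1 => /eqP; rewrite oner_eq0. Qed.

Definition marked_ring : comNzRingType :=
  quotring (ideal_gen_is_ideal (@is_minor K n J)) minors_ideal_proper.

Definition marked_proj : KC -> marked_ring := @quotring_pi _ _ _ _.
HB.instance Definition _ := GRing.RMorphism.on marked_proj.

(* The maximal ideal of the point C = 0 *)
Definition origin : marked_ring -> Prop :=
  ideal_gen (fun x => exists c : cvar J, x = marked_proj (KCvar c)).

Lemma originP (f : KC) : origin (marked_proj f) <-> KC_eval0 f = 0.
Proof.
split.
  suff h x : origin x -> exists2 g, x = marked_proj g & KC_eval0 g = 0.
    move=> /h[g /quotring_pi_eq/minors_ideal_eval0/eqP].
    by rewrite rmorphB /= subr_eq0 => /eqP -> ->.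
  apply: (@ideal_gen_min _ _ (fun x =>
    exists2 g, x = marked_proj g & KC_eval0 g = 0)).
    split=> [|y z [g -> hg] [k -> hk]|a y [g -> hg]].
    - by exists 0; rewrite rmorph0.
    - by exists (g + k); rewrite rmorphD //= hg hk addr0.
    - have [b ->] := quotring_pi_surj a; exists (b * g).
        by rewrite [RHS]rmorphM.
      by rewrite rmorphM /= hg mulr0.
  by move=> y [c ->]; exists (KCvar c); rewrite ?KC_eval0_var.
move=> hf; have [h0 hD hM] := @ideal_gen_is_ideal _
  (fun x : marked_ring => exists c : cvar J, x = marked_proj (KCvar c)).
rewrite [f]monalgE rmorph_sum /= big_seq.
elim/big_ind: _ => // k _.
have [->|kn1] := eqVneq k monalg.one.
  have -> : mkmalgU monalg.one (monalg.mcoeff monalg.one f) = 0 :> KC.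
    by move: hf; rewrite /KC_eval0 => ->; exact: monalgU0.
  by rewrite rmorph0.
have [c hc] : exists c, k c != 0%N.
  apply: contrapT => hno; case/negP: kn1; apply/cmP => c; rewrite cm1.
  by apply/eqP; apply: contrapT => /negP h; apply: hno; exists c.
have -> : k = mulcm (divcm k (ucm c)) (ucm c).
  apply/eqP/cmP => d; rewrite mulcmE divcmE ucmE.
  have [<-|_] := eqVneq c d; last by rewrite subn0 addn0.
  by rewrite subnK // lt0n.
rewrite -[monalg.mcoeff _ _]mulr1 -malgUM.
by rewrite rmorphM; apply: hM; apply: mem_ideal_gen; exists c.
Qed.

Fact origin_prime : is_prime_ideal origin.
Proof.
split; first exact: ideal_gen_is_ideal.
  rewrite -(rmorph1 marked_proj) => /originP/eqP.
  by rewrite rmorph1 oner_eq0.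
move=> x y; have [f ->] := quotring_pi_surj x; have [g ->] := quotring_pi_surj y.
rewrite -[quotring_pi _ _ f]/(marked_proj f) -[quotring_pi _ _ g]/(marked_proj g).
rewrite -rmorphM => /originP/eqP; rewrite rmorphM /= mulf_eq0.
by case/orP => /eqP h; [left|right]; apply/originP.
Qed.

Definition marked_ideal : {mpoly marked_ring[n.+1]} -> Prop :=
  ideal_gen (fun g => exists2 a : M, min_gen J a &
                        g = map_mpoly marked_proj (marked_poly J a)).

Fact marked_ideal_submodule : is_submodule marked_ideal.
Proof.
have [h0 hD hM] := ideal_gen_is_ideal (fun g : {mpoly marked_ring[n.+1]} =>
  exists2 a : M, min_gen J a & g = map_mpoly marked_proj (marked_poly J a)).
by split=> // c x hx; rewrite -mul_mpolyC; apply: hM.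
Qed.

Definition marked_algebra : lmodType marked_ring :=
  quotmod marked_ideal_submodule.

End Origin.

Section Regularity.
Variables (K : fieldType) (n : nat).
Local Notation S := {mpoly K[n.+1]}.

(* ... -> S^(b 1) -> S^(b 0) -> I -> 0, acting on row vectors, is a minimal
   graded free resolution of I; the k-th basis vector of the i-th free module
   has degree d i k. *)
Record is_min_resolution (I : S -> Prop) (b : nat -> nat)
    (d : forall i, 'I_(b i) -> nat) (gens : 'cV[S]_(b 0%N))
    (phi : forall i, 'M[S]_(b i.+1, b i)) : Prop := IsMinResolution {
  res_gens_homog : forall k, gens k 0 \is (d 0%N k).-homog;
  res_homog : forall i k l,
    phi i k l = 0 \/
    (d i l <= d i.+1 k)%N /\ phi i k l \is (d i.+1 k - d i l).-homog;
  res_gens_image : forall f, I f <-> exists u : 'rV_(b 0%N), (u *m gens) 0 0 = f;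
  res_gens_exact : forall u : 'rV_(b 0%N),
    u *m gens = 0 <-> exists v, u = v *m phi 0%N;
  res_exact : forall i (u : 'rV_(b i.+1)),
    u *m phi i = 0 <-> exists v, u = v *m phi i.+1;
  res_min : forall i k l, (phi i k l)@_0%MM = 0
}.

(* m-regularity: the i-th syzygy module of I is generated in degrees <= m + i *)
Definition is_regular (I : S -> Prop) (m : int) : Prop :=
  exists b d gens phi, @is_min_resolution I b d gens phi /\
    forall i k, (d i k)%:Z <= m + i%:Z.

(* r is the infimum of the m such that I is m-regular. *)
Definition is_reg (I : S -> Prop) (r : \bar int) : Prop :=
  (forall m, is_regular I m -> (r <= m%:E)%E) /\
  (forall r', (forall m, is_regular I m -> (r' <= m%:E)%E) -> (r' <= r)%E).

Lemma ex_reg (I : S -> Prop) : exists r, is_reg I r.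
Proof.
have [[m1 hm1]|hno] := pselect (exists m, is_regular I m); last first.
  exists +oo%E; split=> [m hm|r' _]; last exact: leey.
  by case: hno; exists m.
have [[m0 hm0]|hno] := pselect (exists m0, forall m, is_regular I m -> m0 <= m).
  have hex : exists k : nat, `[< is_regular I (m0 + k%:Z) >].
    exists `|m1 - m0|%N; apply/asboolP.
    by rewrite gez0_abs ?subr_ge0 ?hm0 // [m0 + _]addrC subrK.
  case: (ex_minnP hex) => k /asboolP hk kmin.
  exists (m0 + k%:Z)%:E; split=> [m hm|r' hr']; last exact: hr'.
  rewrite lee_fin -lerBrDl; have h0 := hm0 _ hm.
  rewrite -[m - m0]gez0_abs ?subr_ge0 // lez_nat; apply: kmin; apply/asboolP.
  by rewrite gez0_abs ?subr_ge0 // [m0 + _]addrC subrK.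
exists -oo%E; split=> [m _|[r| |] hr'] //; first exact: leNye.
  by case: hno; exists r => m /hr'; rewrite lee_fin.
by have := hr' _ hm1.
Qed.

(* The least m such that I is m-regular, and -oo if I = 0 *)
Definition reg (I : S -> Prop) : \bar int := sval (cid (ex_reg I)).

Lemma regP (I : S -> Prop) : is_reg I (reg I).
Proof. exact: svalP (cid (ex_reg I)). Qed.

End Regularity.

(* Main.v *)
Require Import Defs.
From HB Require Import structures.
From mathcomp Require Import all_boot all_order all_algebra.
From mathcomp Require Import mpoly zify ring.
From mathcomp Require Import boolp constructive_ereal.

(** Flatness.  In degree m, the minors of order dim J_m + 1 of A_m vanish, and
    the rows x^d F_a obtained by choosing one multiple of a generator for each
    term of J_m have a minor on the columns of J_m that is 1 at the origin.  So
    after localisation these rows span all the rows, and the terms outside J are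
    a basis of the quotient: the coordinate of h on the term x^b is, up to a
    unit, the determinant of that minor bordered by h and by the column of b.

    Regularity.  Only the degrees of the generators of J matter: if J is
    m-regular, then B_J lies in degrees <= m, and we build a resolution of I with
    the same bounds by iterating a single step.  A submodule N of a graded free
    module is complementary to the span of the terms outside a disjoint union of
    cones x^a K[x_0..x_r] e_l; for I these are the star decomposition
    of J.  Reduction modulo the elements of N marked on the vertices of
    the cones terminates, because each step decreases the multiplier
    lexicographically.  Hence the multiplicative multiples of the marked elements
    are a basis of N, and the syzygies of these elements are complementary to the
    multiplicative multipliers: they are again of the same shape, for the cones
    x_k K[x_0..x_k] e_a with k > r, whose vertices have one more degree.
    Cancelling the unit entries makes the resolution minimal. *)

Set Implicit Arguments.
Unset Strict Implicit.
Unset Printing Implicit Defensive.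

Import GRing.Theory Order.TTheory Num.Theory.

Local Open Scope ring_scope.

(** * Monomial cones *)

Section Cones.
Variable n : nat.
Implicit Types (a b c d : 'X_{1..n}) (r : nat).

Definition low_vars r a := [forall i : 'I_n, (r < i)%N ==> (a i == 0%N)].

Lemma low_varsP r a :
  reflect (forall i : 'I_n, (r < i)%N -> a i = 0%N) (low_vars r a).
Proof.
apply: (iffP forallP) => h i; first by move=> ri; apply/eqP/(implyP (h i)).
by apply/implyP => /h ->.
Qed.

Lemma low_vars0 r : low_vars r 0%MM.
Proof. by apply/low_varsP => i _; rewrite mnm0E. Qed.

Lemma low_varsD r a b : low_vars r a -> low_vars r b -> low_vars r (a + b)%MM.
Proof.
by move=> /low_varsP ha /low_varsP hb; apply/low_varsP => i hi;
  rewrite mnmDE ha // hb.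
Qed.

(** The exponents read as digits in base [B]: for degrees below [B], comparing weights is comparing
    exponents lexicographically from the largest variable down. *)
Definition weight B a := (\sum_(i < n) a i * B ^ i)%N.

(** The digits of [a] below position [t] sum to less than [B], so they contribute less than [B ^ t],
    which a single unit at position [t] outweighs. *)
Lemma weight_lt B a b (t : 'I_n) :
  (a t < b t)%N -> (forall i : 'I_n, (t < i)%N -> a i = b i) ->
  (mdeg a < B)%N -> (weight B a < weight B b)%N.
Proof.
move=> hab hi hB; have B0 : (0 < B)%N by apply: leq_ltn_trans hB.
have hlow : (\sum_(i < n | (i < t)%N) a i * B ^ i < B ^ t)%N.
  rewrite -(ltn_pmul2l B0); apply: (@leq_ltn_trans (mdeg a * B ^ t)); last first.
    by rewrite ltn_pmul2r // expn_gt0 B0.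
  rewrite mdegE big_distrl big_distrr /=.
  rewrite [X in (_ <= X)%N](bigID (fun i : 'I_n => (i < t)%N)) /=.
  apply: (leq_trans _ (leq_addr _ _)); apply: leq_sum => i it.
  by rewrite mulnCA leq_mul2l -expnS leq_pexp2l ?orbT.
rewrite /weight (bigID (fun i : 'I_n => (t < i)%N)) /=.
rewrite [X in (_ < X)%N](bigID (fun i : 'I_n => (t < i)%N)) /=.
have -> : (\sum_(i < n | (t < i)%N) a i * B ^ i = \sum_(i < n | (t < i)%N) b i * B ^ i)%N.
  by apply: eq_bigr => i /hi ->.
rewrite ltn_add2l (bigD1 t) ?ltnn //= [X in (_ < X)%N](bigD1 t) ?ltnn //=.
apply: (leq_trans _ (leq_addr _ _)).
rewrite (eq_bigl (fun i : 'I_n => (i < t)%N)); last first.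
  by move=> i; rewrite -leqNgt ltn_neqAle andbC -val_eqE.
apply: (@leq_trans ((a t).+1 * B ^ t)%N); last by rewrite leq_mul2r hab orbT.
by rewrite mulSn addnC ltn_add2r.
Qed.

(* Compare d and d' at the largest variable in which they differ: there the
   degree of d' can only be the smaller one, unless a' divides c. *)
Lemma cone_weight B c d a' d' r :
  (c + d = a' + d')%MM -> (forall i : 'I_n, (i < r)%N -> a' i = 0%N) ->
  low_vars r d' -> (mdeg d' < B)%N ->
  ((a' <= c)%MM /\ low_vars r (c - a')%MM) \/ (weight B d' < weight B d)%N.
Proof.
move=> /mnmP e ha /low_varsP hd hB.
have {}e i : (c i + d i = a' i + d' i)%N by have := e i; rewrite !mnmDE.
have [edd|/eqP ndd] := eqVneq d d'.
  left; rewrite edd in e; have {}e i : c i = a' i.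
    by have /eqP := e i; rewrite eqn_add2r => /eqP.
  split; first by apply/mnm_lepP => i; rewrite e.
  by apply/low_varsP => i _; rewrite mnmBE e subnn.
have [i0 hi0] : exists i, d i != d' i.
  by apply: contra_notP ndd => h; apply/mnmP => i; apply/eqP/negP => hh;
    apply: h; exists i; apply/negP.
case: (@arg_maxnP _ i0 (fun i => d i != d' i) (fun i => i : nat) hi0) => t ht tmax.
have above (i : 'I_n) : (t < i)%N -> d' i = d i.
  by move=> ti; apply/eqP; apply: contraTT ti; rewrite -leqNgt eq_sym; apply: tmax.
have [h|h] := ltnP (d' t) (d t); first by right; apply: weight_lt h above hB.
have {h ht}h : (d t < d' t)%N by rewrite ltn_neqAle ht.
have tr : (t <= r)%N.
  by rewrite leqNgt; apply/negP => /hd h0; rewrite h0 in h.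
left; split.
  apply/mnm_lepP => i; have [it|it] := ltnP i t.
    by rewrite ha // (leq_trans it).
  move: it; rewrite leq_eqVlt => /orP[/eqP/val_inj<-|/above hi].
    by have := e t; lia.
  by have := e i; lia.
apply/low_varsP => i ri; have /above hi := leq_ltn_trans tr ri.
by rewrite mnmBE; have := e i; lia.
Qed.

Lemma weight_ub B a : (mdeg a < B)%N -> (weight B a < B * B ^ n)%N.
Proof.
move=> hB; have B0 : (0 < B)%N by apply: leq_ltn_trans hB.
apply: (@leq_ltn_trans (mdeg a * B ^ n)); last first.
  by rewrite ltn_pmul2r // expn_gt0 B0.
rewrite mdegE big_distrl /=; apply: leq_sum => i _.
by rewrite leq_mul2l leq_pexp2l ?orbT // ltnW.
Qed.

End Cones.

Lemma neq0D (V : zmodType) (x y : V) : x + y != 0 -> x != 0 \/ y != 0.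
Proof. by have [->|h _] := eqVneq x 0; [rewrite add0r; right|left]. Qed.

Lemma mcoeffXM (R : comNzRingType) n (m : 'X_{1..n}) (p : {mpoly R[n]}) k :
  ('X_[m] * p)@_k = if (m <= k)%MM then p@_(k - m) else 0.
Proof.
case: ifPn => [h|h]; first by rewrite mulrC -{1}(submK h) addmC mcoeffMX.
apply/memN_msupp_eq0/negP; rewrite mulrC (perm_mem (msuppMX _ _)).
by case/mapP => a _ e; rewrite e lem_addr in h.
Qed.

(** * Marked bases of submodules of free modules *)

Section RowVectors.
Variables (K : fieldType) (n : nat).
Local Notation S := {mpoly K[n]}.

Lemma row_term_ind b (P : 'rV[S]_b -> Prop) (v : 'rV[S]_b) :
  P 0 -> (forall u w, P u -> P w -> P (u + w)) ->
  (forall (c : K) u, P u -> P (c%:MP *: u)) ->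
  (forall l a, (v 0 l)@_a != 0 -> P ('X_[a] *: delta_mx 0 l)) -> P v.
Proof.
move=> P0 PD PZ Pv; rewrite (row_sum_delta v); elim/big_ind: _ => // l _.
rewrite [v 0 l]mpolyE scaler_suml big_seq; elim/big_ind: _ => // a ha.
by rewrite -mul_mpolyC -scalerA; apply: PZ; apply: Pv; rewrite -mcoeff_msupp.
Qed.

Lemma coef_term b (a a' : 'X_{1..n}) (l l' : 'I_b) :
  (('X_[a] *: delta_mx 0 l : 'rV[S]_b) 0 l')@_a' = ((l' == l) && (a' == a))%:R.
Proof.
rewrite !mxE /= mulr_natr; case: eqP => _; rewrite ?mulr1n ?mulr0n ?mcoeff0 //.
by rewrite mcoeffX eq_sym.
Qed.

Lemma coef_term_neq0 b (a a' : 'X_{1..n}) (l l' : 'I_b) :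
  (('X_[a] *: delta_mx 0 l : 'rV[S]_b) 0 l')@_a' != 0 -> l' = l /\ a' = a.
Proof. by rewrite coef_term; case: andP => [[/eqP -> /eqP ->]|_]; rewrite ?eqxx. Qed.

Definition graded b1 b0 (d1 : 'I_b1 -> nat) (d0 : 'I_b0 -> nat)
    (f : 'M[S]_(b1, b0)) : Prop :=
  forall k l a, (f k l)@_a != 0 -> (mdeg a + d0 l)%N = d1 k.

Record cones b0 b1 := Cones {
  pos : 'I_b1 -> 'I_b0;
  expo : 'I_b1 -> 'X_{1..n};
  cls : 'I_b1 -> nat
}.

Section OneMarkedBasis.
Variables (b0 b1 : nat) (d0 : 'I_b0 -> nat) (d1 : 'I_b1 -> nat).
Variables (C : cones b0 b1) (f : 'M[S]_(b1, b0)).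

Definition in_cone k l (a : 'X_{1..n}) :=
  [&& pos C k == l, (expo C k <= a)%MM & low_vars (cls C k) (a - expo C k)%MM].

Definition in_lead l a := [exists k, in_cone k l a].

(* The terms [x^a e_l] with [in_lead l a] form a monomial submodule of the free
   module, presented as a disjoint union of cones
   [x^(expo k) K[x_0..x_(cls k)] e_(pos k)]; row k of f is the polynomial marked
   on the vertex of the k-th cone. *)
Record marked_basis : Prop := MarkedBasis {
  mb_deg : forall k, d1 k = (mdeg (expo C k) + d0 (pos C k))%N;
  mb_graded : graded d1 d0 f;
  mb_low : forall k (i : 'I_n), (i < cls C k)%N -> expo C k i = 0%N;
  mb_disj : forall k k' l a, in_cone k l a -> in_cone k' l a -> k = k';
  mb_mark : forall k l a, in_lead l a ->
    (f k l)@_a = ((l == pos C k) && (a == expo C k))%:R;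
  mb_free : forall u : 'rV_b1,
    (forall l a, in_lead l a -> ((u *m f) 0 l)@_a = 0) -> u *m f = 0
}.

Hypothesis mb : marked_basis.

Lemma in_cone_vertex k d : low_vars (cls C k) d ->
  in_cone k (pos C k) (d + expo C k)%MM.
Proof. by move=> h; rewrite /in_cone eqxx lem_addl addmK. Qed.

Definition is_multiplier (q : 'rV[S]_b1) : Prop :=
  forall k a, (q 0 k)@_a != 0 -> low_vars (cls C k) a.

(** [E] constrains the degrees that occur: a singleton yields a homogeneous multiplier, [predT]
    forgets the grading. *)
Definition has_nf (E : pred nat) (v : 'rV[S]_b0) : Prop :=
  exists q g, [/\ v = q *m f + g, is_multiplier q,
    forall k a, (q 0 k)@_a != 0 -> E (mdeg a + d1 k)%N
    & forall l a, (g 0 l)@_a != 0 -> ~~ in_lead l a].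

Lemma has_nf0 E : has_nf E 0.
Proof.
exists 0, 0; split=> [|k a|k a|l a]; first by rewrite mul0mx addr0.
all: by rewrite mxE mcoeff0 eqxx.
Qed.

Lemma has_nfD E u w : has_nf E u -> has_nf E w -> has_nf E (u + w).
Proof.
move=> [q [g [-> mq Eq hg]]] [q' [g' [-> mq' Eq' hg']]]; exists (q + q'), (g + g').
split=> [|k a|k a|l a]; first by rewrite mulmxDl addrACA.
all: by rewrite mxE mcoeffD => /neq0D[]; auto.
Qed.

Lemma has_nfZ E (c : K) u : has_nf E u -> has_nf E (c%:MP *: u).
Proof.
move=> [q [g [-> mq Eq hg]]]; exists (c%:MP *: q), (c%:MP *: g).
split=> [|k a|k a|l a]; first by rewrite scalerDr scalemxAl.
all: by rewrite mxE mcoeffCM mulf_eq0 negb_or => /andP[_]; auto.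
Qed.

Lemma nf_notin_lead E l a : ~~ in_lead l a -> has_nf E ('X_[a] *: delta_mx 0 l).
Proof.
move=> nl; exists 0, ('X_[a] *: delta_mx 0 l).
split=> [|k b|k b|l' b]; first by rewrite mul0mx add0r.
1,2: by rewrite mxE mcoeff0 eqxx.
by case/coef_term_neq0 => -> ->.
Qed.

(** Induction on a bound for the weight of the multiplier [d]. Subtracting ['X_[d] *: row k f]
    leaves ['X_[d]] times terms outside the lead module, and [cone_weight] shows that those falling
    back into a cone have a multiplier of smaller weight. Homogeneity keeps the base [e.+1] above
    the degrees of all multipliers. *)
Lemma nf_term (E : pred nat) e w l a : (mdeg a + d0 l)%N = e -> E e ->
  (forall k, in_cone k l a -> (weight e.+1 (a - expo C k)%MM < w)%N) ->
  has_nf E ('X_[a] *: delta_mx 0 l).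
Proof.
move=> + Ee; elim: w l a => [|w IH] l a hl hw;
  have [/existsP[k hk]|nl] := boolP (in_lead l a); try exact: nf_notin_lead.
  by have := hw _ hk.
have /and3P[/eqP pk le_a lowd] := hk.
set d := (a - expo C k)%MM in lowd; have ad : a = (d + expo C k)%MM by rewrite submK.
have hd1 : (mdeg d + d1 k)%N = e by rewrite mb_deg // pk addnA -mdegD -ad.
have -> : 'X_[a] *: delta_mx 0 l = 'X_[d] *: delta_mx 0 k *m f +
    'X_[d] *: ('X_[expo C k] *: delta_mx 0 l - row k f).
  by rewrite -scalemxAl -rowE -scalerDr addrC subrK scalerA -mpolyXD -ad.
apply: has_nfD.
  exists ('X_[d] *: delta_mx 0 k), 0; split=> [|k' b|k' b|l' b].
  - by rewrite addr0.
  - by case/coef_term_neq0 => -> ->.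
  - by case/coef_term_neq0 => -> ->; rewrite hd1.
  - by rewrite mxE mcoeff0 eqxx.
apply: row_term_ind; [exact: has_nf0|exact: has_nfD|exact: has_nfZ|].
move=> l' a'; rewrite mxE mcoeffXM; case: ifP => [le_d|]; last by rewrite eqxx.
set c := (a' - d)%MM; have a'E : a' = (c + d)%MM by rewrite submK.
rewrite !mxE /= mulr_natr mcoeffB => hc.
have hXc : ('X_[expo C k] *+ (l' == l) : S)@_c = ((l' == pos C k) && (c == expo C k))%:R.
  rewrite pk; case: eqP => _; rewrite ?mulr1n ?mulr0n ?mcoeff0 //.
  by rewrite mcoeffX eq_sym.
have ncl : ~~ in_lead l' c.
  by apply: contraNN hc => hc; rewrite (mb_mark mb) // hXc subrr.
have dc : (mdeg c + d0 l')%N = d1 k.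
  have [h0|h0] := eqVneq (f k l')@_c 0; last exact: (mb_graded mb h0).
  move: hc; rewrite h0 subr0 hXc; case: andP => [[/eqP -> /eqP ->] _|]; last first.
    by rewrite eqxx.
  by rewrite (mb_deg mb).
have da' : (mdeg a' + d0 l')%N = e by rewrite a'E mdegD -hd1 -dc; lia.
apply: IH => // k' hk'; have /and3P[/eqP pk' le' low'] := hk'.
have := @cone_weight n e.+1 c d (expo C k') (a' - expo C k')%MM (cls C k').
case.
- by rewrite -a'E addmC submK.
- exact: (mb_low mb).
- exact: low'.
- by apply: leq_ltn_trans (mdegB _ _) _; rewrite ltnS -da' leq_addr.
- case=> h1 h2; case/negP: ncl; apply/existsP; exists k'.
  by rewrite /in_cone pk' eqxx h1 h2.
- by move=> h; apply: (leq_trans h); rewrite -ltnS; apply: hw.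
Qed.

Lemma nf_exists (E : pred nat) (v : 'rV[S]_b0) :
  (forall l a, (v 0 l)@_a != 0 -> E (mdeg a + d0 l)%N) -> has_nf E v.
Proof.
move=> hv; apply: row_term_ind; [exact: has_nf0|exact: has_nfD|exact: has_nfZ|].
move=> l a /hv hE; set e := (mdeg a + d0 l)%N in hE.
apply: (@nf_term E e (e.+1 * e.+1 ^ n) l a) => // k _.
by apply/weight_ub/(leq_ltn_trans (mdegB _ _)); rewrite ltnS leq_addr.
Qed.

(** Downward induction on the weight of [a]. At the lead term [d + expo C k], the pair [(k, d)]
    contributes its own coefficient; any other contribution would come from a tail, and
    [cone_weight] then forces a larger weight, where the coefficient is already known to vanish. *)
Lemma nf_unique (q : 'rV[S]_b1) : is_multiplier q ->
  (forall l a, in_lead l a -> ((q *m f) 0 l)@_a = 0) -> q = 0.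
Proof.
move=> mq hq.
pose D := (\max_k msize (q 0%R k)).
have hD k a : (q 0 k)@_a != 0 -> (mdeg a < D)%N.
  rewrite -mcoeff_msupp => /msize_mdeg_lt h; apply: (leq_trans h).
  exact: (@leq_bigmax _ (fun k => msize (q 0 k))).
suff h j k a : (D * D ^ n - weight D a < j)%N -> (q 0 k)@_a = 0.
  by apply/rowP => k; rewrite mxE; apply/mpolyP => a; rewrite mcoeff0; apply: h.
elim: j k a => // j IH k d hj; have [//|qkd] := eqVneq (q 0 k)@_d 0.
rewrite -(hq (pos C k) (d + expo C k)%MM); last first.
  by apply/existsP; exists k; apply/in_cone_vertex/mq.
have term k' d' : (q 0 k')@_d' != 0 -> (k', d') != (k, d) ->
    ('X_[d'] * f k' (pos C k))@_(d + expo C k) = 0.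
  move=> qk' nkd; rewrite mcoeffXM; case: ifP => // le_d'.
  set c := (_ - d')%MM; have cE : (c + d' = expo C k + d)%MM.
    by rewrite submK // addmC.
  (* If [c] is a lead term, the marking leaves only the vertex of [k'], and disjointness of the
     cones identifies [(k', d')] with [(k, d)]. *)
  have [hc|nc] := boolP (in_lead (pos C k) c).
    rewrite (mb_mark mb) //; case: eqP => //= pkk'; case: eqP => //= ck'.
    case/negP: nkd; have hk' : in_cone k' (pos C k) (d + expo C k)%MM.
      by rewrite addmC -cE ck' addmC pkk' in_cone_vertex //; apply: mq qk'.
    have kk' := mb_disj mb hk' (in_cone_vertex (mq _ _ qkd)).
    move: cE; rewrite ck' kk' => /addmI ->; exact: eqxx.
  have [] := cone_weight cE (mb_low mb (k := k)) (mq _ _ qkd) (hD _ _ qkd).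
    by case=> h1 h2; case/negP: nc; apply/existsP; exists k; rewrite /in_cone eqxx h1 h2.
  move=> hw; case/eqP: qk'; apply: IH.
  have := weight_ub (hD _ _ qkd); move: hw hj; lia.
rewrite mxE (raddf_sum (mcoeff _)) /= (bigD1 k) //= [X in _ + X]big1 ?addr0; last first.
  move=> k' nk'; rewrite [q 0 k']mpolyE mulr_suml (raddf_sum (mcoeff _)) /=.
  rewrite big_seq big1 // => d' hd'; rewrite -scalerAl mcoeffZ term ?mulr0 //.
    by rewrite -mcoeff_msupp.
  by apply: contraNneq nk' => -[->].
rewrite [in RHS](mpolyE (q 0 k)) mulr_suml (raddf_sum (mcoeff _)) /=.
rewrite (bigD1_seq d) ?msupp_uniq ?mcoeff_msupp //= [X in _ + X]big_seq_cond big1 ?addr0.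
  rewrite -scalerAl mcoeffZ mcoeffXM lem_addr addmC addmK (mb_mark mb).
    by rewrite !eqxx mulr1.
  apply/existsP; exists k; rewrite -[X in in_cone _ _ X]add0m.
  exact/in_cone_vertex/low_vars0.
move=> d' /andP[hd' nd']; rewrite -scalerAl mcoeffZ term ?mulr0 //.
  by rewrite -mcoeff_msupp.
by apply: contraNneq nd' => -[->].
Qed.

End OneMarkedBasis.

Definition exact_mx b2 b1 b0 (g : 'M[S]_(b2, b1)) (f : 'M[S]_(b1, b0)) : Prop :=
  forall u : 'rV_b1, u *m f = 0 <-> exists v, u = v *m g.

(** * Syzygies of a marked basis *)

Section Syzygies.
Variables (b0 b1 : nat) (d0 : 'I_b0 -> nat) (d1 : 'I_b1 -> nat).
Variables (C : cones b0 b1) (f : 'M[S]_(b1, b0)).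
Hypothesis mb : marked_basis d0 d1 C f.

(** The remainder of the normal form lies in the row span of [f] and has no lead term, so [mb_free]
    kills it. *)
Lemma multiplier_exists (E : pred nat) (v : 'rV[S]_b0) :
  (exists u : 'rV_b1, v = u *m f) ->
  (forall l a, (v 0 l)@_a != 0 -> E (mdeg a + d0 l)%N) ->
  exists q, [/\ v = q *m f, is_multiplier C q
    & forall k a, (q 0 k)@_a != 0 -> E (mdeg a + d1 k)%N].
Proof.
move=> [u vE] /(nf_exists mb)[q [g [vE' mq Eq hg]]]; exists q; split=> //.
have gE : g = (u - q) *m f by rewrite mulmxBl -vE vE' addrC addKr.
rewrite vE'; suff -> : g = 0 by rewrite addr0.
by rewrite gE; apply: (mb_free mb) => l a; rewrite -gE; apply: contraTeq; apply: hg.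
Qed.

Definition syz_index := [pred x : 'I_b1 * 'I_n | (cls C x.1 < x.2)%N].

(** A term [x^a e_k] that is not a multiplier goes to the cone of the largest variable dividing
    [x^a]. *)
Definition syz_cones : cones b1 #|syz_index| :=
  Cones (fun j => (enum_val j).1) (fun j => U_((enum_val j).2)%MM)
    (fun j => (enum_val j).2).

Lemma syz_lead k a : in_lead syz_cones k a = ~~ low_vars (cls C k) a.
Proof.
apply/existsP/idP => [[j /and3P[/eqP <- /= ha _]]|].
  apply/negP => /low_varsP /(_ (enum_val j).2) h; move: ha.
  by rewrite lep1mP h //; exact: (enum_valP j).
rewrite negb_forall => /existsP[i0]; rewrite negb_imply => /andP[ki0 ai0].
case: (@arg_maxnP _ i0 (fun i => a i != 0%N) (fun i => i : nat) ai0) => i ai imax.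
have hi : (k, i) \in syz_index.
  by rewrite inE /=; apply: leq_trans ki0 (imax _ ai0).
exists (enum_rank_in hi (k, i)).
rewrite /in_cone /= enum_rankK_in //= eqxx lep1mP ai /=.
apply/low_varsP => t it; rewrite mnmBE; suff -> : a t = 0%N by [].
by apply/eqP; apply: contraTT it => /imax; rewrite -leqNgt.
Qed.

Lemma syz_disj j j' k a :
  in_cone syz_cones j k a -> in_cone syz_cones j' k a -> j = j'.
Proof.
move=> /and3P[/eqP p le lo] /and3P[/eqP p' le' lo']; apply: enum_val_inj.
rewrite /= in p le lo p' le' lo'; move: p p' le lo le' lo'.
case: (enum_val j) => _ i /= ->; case: (enum_val j') => _ i' /= ->.
rewrite !lep1mP => ai /low_varsP lo ai' /low_varsP lo'; congr pair.
apply/val_inj/eqP; rewrite eqn_leq; apply/andP; split; rewrite leqNgt;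
  apply/negP => h.
  have := lo' _ h; rewrite mnmBE mnm1E; case: eqP h => [->|_ _]; first by rewrite ltnn.
  by rewrite subn0; apply/eqP.
have := lo _ h; rewrite mnmBE mnm1E; case: eqP h => [->|_ _]; first by rewrite ltnn.
by rewrite subn0; apply/eqP.
Qed.

(** Rewriting a non-multiplicative product of a row of [f] by a multiplier [Q j] yields a marked
    syzygy. By [nf_unique], a multiplier that is a syzygy of [f] is zero, which gives both [mb_free]
    and exactness. *)
Lemma marked_basis_syz :
  exists b2 (d2 : 'I_b2 -> nat) (C2 : cones b1 b2) (f2 : 'M[S]_(b2, b1)),
    [/\ marked_basis d1 d2 C2 f2, exact_mx f2 f
      & forall j, exists k, d2 j = (d1 k).+1].
Proof.
pose d2 (j : 'I_#|syz_index|) := (d1 (enum_val j).1).+1.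
have hQ (j : 'I_#|syz_index|) : exists q : 'rV[S]_b1,
    [/\ 'X_[U_((enum_val j).2)] *: row (enum_val j).1 f = q *m f, is_multiplier C q
    & forall k a, (q 0 k)@_a != 0 -> (mdeg a + d1 k)%N == d2 j].
  apply: (@multiplier_exists (pred1 (d2 j))).
    exists ('X_[U_((enum_val j).2)] *: delta_mx 0 (enum_val j).1).
    by rewrite -scalemxAl -rowE.
  move=> l a; rewrite !mxE mcoeffXM; case: ifP => [le|_]; last by rewrite eqxx.
  move=> /(mb_graded mb) h; rewrite /= /d2 -h -[in X in X == _](submK le) mdegD mdeg1.
  by rewrite addnC addnA addn1 addnC.
case/fin_all_exists: hQ => Q hQ.
pose f2 : 'M[S]_(#|syz_index|, b1) :=
  \matrix_j ('X_[U_((enum_val j).2)] *: delta_mx 0 (enum_val j).1 - Q j).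
have f2E j k a : (f2 j k)@_a =
    ((k == (enum_val j).1) && (a == U_((enum_val j).2)%MM))%:R - (Q j 0 k)@_a.
  by rewrite -coef_term -mcoeffB !mxE.
have f2f : f2 *m f = 0.
  apply/row_matrixP => j; rewrite row_mul rowK row0 mulmxBl -scalemxAl -rowE.
  by case: (hQ j) => -> _ _; rewrite subrr.
have mb2 : marked_basis d1 d2 syz_cones f2.
  split.
  - by move=> j; rewrite /d2 /= mdeg1.
  - move=> j k a; rewrite f2E => /neq0D[].
      case: andP => [[/eqP -> /eqP ->] _|]; last by rewrite eqxx.
      by rewrite mdeg1 add1n.
    by rewrite oppr_eq0; case: (hQ j) => _ _ h /h/eqP.
  - move=> j i /= h; rewrite mnm1E; case: eqP h => // ->; by rewrite ltnn.
  - exact: syz_disj.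
  - move=> j k a; rewrite syz_lead f2E => h; suff -> : (Q j 0 k)@_a = 0 by rewrite subr0.
    by case: (hQ j) => _ mq _; apply: contraNeq h; exact: mq.
  - move=> u hu; apply: (nf_unique mb).
      by move=> k a; apply: contraNT => h; rewrite hu // syz_lead.
    by move=> l a _; rewrite -mulmxA f2f mulmx0 mxE mcoeff0.
exists _, d2, syz_cones, f2; split=> //; last by move=> j; exists (enum_val j).1.
move=> u; split=> [uf|[v ->]]; last by rewrite -mulmxA f2f mulmx0.
have [q [g [uE _ _ hg]]] := @nf_exists _ _ _ _ _ _ mb2 predT u (fun _ _ _ => isT).
exists q; rewrite uE (_ : g = 0) ?addr0 //; apply: (nf_unique mb).
  by move=> k a /hg; rewrite syz_lead negbK.
move=> l a _; have -> : g *m f = 0; last by rewrite mxE mcoeff0.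
by move: uf; rewrite uE mulmxDl -mulmxA f2f mulmx0 add0r.
Qed.

End Syzygies.

(** A graded resolution continuing [f], with generators in degrees at most [m], [m + 1], and so on.
    Living in [Prop], each stage only asserts that a next one exists; actual sequences are chosen
    later. *)
CoInductive lin_res (m : int) b1 b0 (d1 : 'I_b1 -> nat) (f : 'M[S]_(b1, b0)) :
    Prop :=
  LinRes b2 (d2 : 'I_b2 -> nat) (g : 'M[S]_(b2, b1)) of
    (forall k, (d1 k)%:Z <= m) & graded d2 d1 g & exact_mx g f
    & lin_res (m + 1) d2 g.

Lemma marked_basis_lin_res (m : int) b0 b1 (d0 : 'I_b0 -> nat)
    (d1 : 'I_b1 -> nat) (C : cones b0 b1) (f : 'M[S]_(b1, b0)) :
  marked_basis d0 d1 C f -> (forall k, (d1 k)%:Z <= m) -> lin_res m d1 f.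
Proof.
move: m b0 b1 d0 d1 C f; cofix IH => m b0 b1 d0 d1 C f mb hm.
destruct (marked_basis_syz mb) as [b2 [d2 [C2 [f2 [mb2 ex hd]]]]].
apply: (@LinRes m b1 b0 d1 f b2 d2 f2 hm (mb_graded mb2) ex).
apply: (IH _ _ _ _ _ _ _ mb2) => j; have [k ->] := hd j.
by rewrite -addn1 PoszD lerD2r.
Qed.

End RowVectors.

(** * Minimal resolutions *)

Section MinimalResolution.
Variables (K : fieldType) (n : nat).
Local Notation S := {mpoly K[n]}.

Lemma coefM_neq0 (p q : S) a : (p * q)@_a != 0 ->
  exists a1 a2, [/\ a = (a1 + a2)%MM, p@_a1 != 0 & q@_a2 != 0].
Proof.
rewrite -mcoeff_msupp => /msuppM_le/allpairsP[[a1 a2] /= [h1 h2 ->]].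
by exists a1, a2; rewrite -!mcoeff_msupp.
Qed.

(** * Cancellation of a unit entry in a resolution *)

Section Cancel.
Variables (b0 b1 b2 b3 b4 : nat).
Variables (f : 'M[S]_(b1.+1, b0)) (g : 'M[S]_(b2.+1, b1.+1)).
Variables (h : 'M[S]_(b3, b2.+1)) (i : 'M[S]_(b4, b3)).
Variables (k : 'I_b2.+1) (l : 'I_b1.+1) (c : K).
Hypotheses (gkl : g k l = c%:MP) (c0 : c != 0).
Hypotheses (exgf : exact_mx g f) (exhg : exact_mx h g) (exih : exact_mx i h).

Lemma mulmx_col'_row' p m q (j : 'I_m.+1) (A : 'M[S]_(p, m.+1)) (B : 'M_(m.+1, q)) :
  A *m B = col j A *m row j B + col' j A *m row' j B.
Proof.
apply/matrixP => x y; rewrite !mxE (bigD1_ord j) //= big_ord1 !mxE.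
by congr (_ + _); apply: eq_bigr => t _; rewrite !mxE.
Qed.

Lemma eq_col_col' p m (j : 'I_m.+1) (A B : 'M[S]_(p, m.+1)) :
  col j A = col j B -> col' j A = col' j B -> A = B.
Proof.
move=> /matrixP h1 /matrixP h2; apply/matrixP => x y.
case: (unliftP j y) => [y' ->|->]; first by have := h2 x y'; rewrite !mxE.
by have := h1 x 0; rewrite !mxE.
Qed.

Lemma col_ext p m (j : 'I_m.+1) (x : 'cV[S]_p) (A : 'M[S]_(p, m)) :
  exists B : 'M_(p, m.+1), col j B = x /\ col' j B = A.
Proof.
exists (\matrix_(s, t) oapp (A s) (x s 0) (unlift j t)); split.
  by apply/matrixP => s t; rewrite !mxE unlift_none /= ord1.
by apply/matrixP => s t; rewrite !mxE liftK.
Qed.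

(** Gaussian elimination with pivot [c] in row [k] and column [l], which are then deleted. *)
Definition schur : 'M[S]_(b2, b1) :=
  row' k (col' l g) - (c^-1)%:MP *: (row' k (col l g) *m row k (col' l g)).

Lemma mul_col_pivot p (v : 'M[S]_(p, b2.+1)) :
  col l (v *m g) = c%:MP *: col k v + col' k v *m row' k (col l g).
Proof.
rewrite colE -mulmxA -colE (mulmx_col'_row' k); congr (_ + _).
have -> : row k (col l g) = c%:MP%:M.
  by apply/matrixP => x y; rewrite !mxE !ord1 eqxx gkl.
by rewrite -mul_mx_scalar.
Qed.

(** As [c] is invertible, coordinate [k] is determined by the others; vectors are extended across
    the deleted coordinate by this value. *)
Lemma pivot_eq0 p (v : 'M[S]_(p, b2.+1)) :
  col l (v *m g) = 0 <->
  col k v = - (c^-1)%:MP *: (col' k v *m row' k (col l g)).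
Proof.
have cc : (c^-1)%:MP * c%:MP = 1 :> S by rewrite -mpolyCM mulVf.
rewrite mul_col_pivot; split=> [/eqP|->].
  rewrite addr_eq0 => /eqP e; rewrite scaleNr -scalerN -(_ : c%:MP *: col k v = - _) //.
  by rewrite scalerA cc scale1r.
by rewrite scalerA mulrN mulrC cc scaleN1r addNr.
Qed.

Lemma mul_schur p (v : 'M[S]_(p, b2.+1)) : col l (v *m g) = 0 ->
  col' l (v *m g) = col' k v *m schur.
Proof.
move=> /pivot_eq0 e; rewrite mulmxBr -scalemxAr mulmxA.
have -> : col' l (v *m g) = v *m col' l g.
  by apply/matrixP => x y; rewrite !mxE; apply: eq_bigr => t _; rewrite !mxE.
by rewrite (mulmx_col'_row' k) e -scalemxAl scaleNr addrC.
Qed.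

Lemma exact_comp0 p q r s (A : 'M[S]_(p, q)) (B : 'M_(q, r)) (v : 'M_(s, p)) :
  exact_mx A B -> v *m A *m B = 0.
Proof.
move=> ex; apply/row_matrixP => j; rewrite row_mul row0; apply/ex.
by exists (row j v); rewrite row_mul.
Qed.

Lemma col'_mul p q r (j : 'I_r.+1) (A : 'M[S]_(p, q)) (B : 'M_(q, r.+1)) :
  col' j (A *m B) = A *m col' j B.
Proof. by apply/matrixP => x y; rewrite !mxE; apply: eq_bigr => t _; rewrite !mxE. Qed.

(** A relation among the remaining rows of [f] is extended by 0 at [l]; a combination of the
    remaining rows of [g] is extended at [k] by the value from [pivot_eq0], so that its image has
    coordinate 0 at [l]. *)
Lemma exact_schur_row' : exact_mx schur (row' l f).
Proof.
move=> u'; split=> [u'f|[v' ->]].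
  have [u [ul u'E]] := col_ext l 0 u'.
  have /exgf[v uE] : u *m f = 0 by rewrite (mulmx_col'_row' l) ul u'E mul0mx add0r.
  by exists (col' k v); rewrite -u'E uE -mul_schur // -uE.
have [v [vk v'E]] := col_ext k (- (c^-1)%:MP *: (v' *m row' k (col l g))) v'.
have vl : col l (v *m g) = 0 by apply/pivot_eq0; rewrite vk v'E.
have := exact_comp0 v exgf.
by rewrite (mulmx_col'_row' l) vl mul0mx add0r mul_schur // v'E.
Qed.

Lemma exact_col'_schur : exact_mx (col' k h) schur.
Proof.
move=> v'; split=> [v'g|[w ->]].
  have [v [vk v'E]] := col_ext k (- (c^-1)%:MP *: (v' *m row' k (col l g))) v'.
  have vl : col l (v *m g) = 0 by apply/pivot_eq0; rewrite vk v'E.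
  have /exhg[w vE] : v *m g = 0.
    apply: (@eq_col_col' _ _ l); first by rewrite vl col0.
    by rewrite mul_schur // v'E v'g; apply/matrixP => x y; rewrite !mxE.
  by exists w; rewrite -v'E vE col'_mul.
have vg := exact_comp0 w exhg.
rewrite -col'_mul -mul_schur vg ?col0 //.
by apply/matrixP => x y; rewrite !mxE.
Qed.

Lemma exact_col' : exact_mx i (col' k h).
Proof.
move=> w; split=> [wh|/exih wh]; last first.
  by rewrite -col'_mul wh; apply/matrixP => x y; rewrite !mxE.
apply/exih/(@eq_col_col' _ _ k); rewrite ?col0; last first.
  by rewrite col'_mul wh; apply/matrixP => x y; rewrite !mxE.
have /pivot_eq0 -> : col l (w *m h *m g) = 0 by rewrite (exact_comp0 _ exhg) col0.
by rewrite col'_mul wh mul0mx scaler0.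
Qed.

(** Row [k] of [g] is a relation in which row [l] of [f] has the invertible coefficient [c]. *)
Lemma span_row' (u : 'rV_b1.+1) : exists u', u *m f = u' *m row' l f.
Proof.
have := exact_comp0 (delta_mx 0 k : 'rV_b2.+1) exgf.
rewrite -rowE (mulmx_col'_row' l).
have -> : col l (row k g) = c%:MP%:M by apply/matrixP => x y; rewrite !mxE !ord1 eqxx gkl.
rewrite mul_scalar_mx => /eqP; rewrite addr_eq0 => /eqP e.
exists (col' l u - col l u *m ((c^-1)%:MP *: col' l (row k g))).
rewrite (mulmx_col'_row' l) mulmxBl addrC; congr (_ + _).
rewrite -mulmxA -scalemxAl -mulmxN -scalerN -e scalerA -mpolyCM mulVf //.
by rewrite mpolyC1 scale1r.
Qed.

Lemma graded_schur (d2 : 'I_b2.+1 -> nat) (d1 : 'I_b1.+1 -> nat) :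
  graded d2 d1 g -> graded (d2 \o lift k) (d1 \o lift l) schur.
Proof.
move=> gr x y a; rewrite !mxE big_ord1 !mxE mcoeffB mcoeffCM.
case/neq0D; first exact: gr.
rewrite oppr_eq0 mulf_eq0 negb_or => /andP[_] /coefM_neq0[a1 [a2 [-> /gr h1 /gr h2]]].
(* The pivot is a nonzero constant, so the two deleted generators have equal degrees. *)
have := gr k l 0%MM; rewrite gkl mcoeffC eqxx mulr1 => /(_ c0).
by rewrite mdeg0 mdegD /= -h1; move: h2; lia.
Qed.

End Cancel.

Definition minimal_mx b1 b0 (g : 'M[S]_(b1, b0)) : Prop :=
  forall k l, (g k l)@_0%MM = 0.

(** Induction on the number of rows of [f]: a unit entry of [g] makes one row of [f] redundant, and
    cancelling it preserves the row span. Only the first map [g] is made minimal here. *)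
Lemma lin_res_min m b1 b0 (d1 : 'I_b1 -> nat) (f : 'M[S]_(b1, b0)) :
  lin_res m d1 f ->
  exists b1' (s : 'I_b1' -> 'I_b1),
    (exists b2 (d2 : 'I_b2 -> nat) (g : 'M[S]_(b2, b1')),
      [/\ forall k, (d1 (s k))%:Z <= m, graded d2 (d1 \o s) g,
          exact_mx g (rowsub s f), minimal_mx g & lin_res (m + 1) d2 g]) /\
    forall u : 'rV_b1, exists u', u *m f = u' *m rowsub s f.
Proof.
elim: b1 d1 f => [|b1 IH] d1 f [b2 d2 g hd gr ex lr].
  have fE : rowsub id f = f by apply/matrixP => x y; rewrite mxE.
  exists 0%N, id; split; last by move=> u; exists u; rewrite fE.
  by exists b2, d2, g; rewrite fE; split=> // k [].
case: (pickP [pred x : 'I_b2 * 'I_b1.+1 | (g x.1 x.2)@_0%MM != 0])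
  => [[k l]|hmin]; last first.
  have fE : rowsub id f = f by apply/matrixP => x y; rewrite mxE.
  exists b1.+1, id; split; last by move=> u; exists u; rewrite fE.
  exists b2, d2, g; rewrite fE; split=> // k l.
  by have /negbFE/eqP := hmin (k, l).
move=> /= c0; set c := (g k l)@_0 in c0.
(* By homogeneity, an entry with nonzero constant term is constant. *)
have gkl : g k l = c%:MP.
  apply/mpolyP => a; rewrite mcoeffC; case: eqP => [->|/eqP na]; first by rewrite mulr1.
  rewrite mulr0; apply/eqP; apply: contraNT na => /gr ha; have := gr _ _ _ c0.
  by rewrite -ha mdeg0 => /addIn/eqP; rewrite eq_sym mdeg_eq0.
case: b2 d2 g gr ex lr k c c0 gkl => [|b2] d2 g gr ex lr; first by case.
move=> k c c0 gkl.
(* Cancellation changes [g] and the columns of [h] but leaves [i] fixed, so two stages are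
   unfolded. *)
case: lr => b3 d3 h hd2 gr3 ex3 [b4 d4 i hd3 gr4 ex4 lr4].
have lr' : lin_res m (d1 \o lift l) (row' l f).
  apply: (LinRes (d2 := (d2 \o lift k)) (g := (schur g k l c))).
  - by move=> j; apply: hd.
  - exact: graded_schur.
  - exact: exact_schur_row'.
  apply: (LinRes (d2 := d3) (g := (col' k h))).
  - by move=> j; apply: hd2.
  - by move=> x y a; rewrite mxE; apply: gr3.
  - exact: exact_col'_schur.
  by apply: (LinRes (d2 := d4) (g := i)) => //; apply: exact_col' gkl c0 ex3 ex4.
have [b1' [s [[b2' [d2' [g' [h1 h2 h3 h4 h5]]]] span]]] := IH _ _ lr'.
have fE : rowsub (lift l \o s) f = rowsub s (row' l f).
  by apply/matrixP => x y; rewrite !mxE.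
exists b1', (lift l \o s); split; first by exists b2', d2', g'; rewrite fE.
move=> u; have [u' ->] := span_row' gkl c0 ex u.
by have [u'' ->] := span u'; exists u''; rewrite fE.
Qed.

(** * Assembling the minimal resolution by iteration *)

Record res_state := ResState {
  rs_m : int;
  rs_c : nat;
  rs_b : nat;
  rs_d : 'I_rs_b -> nat;
  rs_phi : 'M[S]_(rs_b, rs_c);
  rs_bound : forall k, (rs_d k)%:Z <= rs_m;
  rs_res : exists b2 (d2 : 'I_b2 -> nat) (g : 'M[S]_(b2, rs_b)),
    [/\ graded d2 rs_d g, exact_mx g rs_phi, minimal_mx g
      & lin_res (rs_m + 1) d2 g]
}.

(** Discarding redundant rows of the minimal map [g] keeps its span and its minimality, and makes
    room for a minimal map after it, so the construction can be repeated. *)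
Lemma res_next (x : res_state) :
  {y : {b : nat & ('I_b -> nat) * 'M[S]_(b, rs_b x)}%type |
    let b2 := tag y in let d2 := (tagged y).1 in let g := (tagged y).2 in
    [/\ graded d2 (@rs_d x) g, exact_mx g (rs_phi x), minimal_mx g,
        forall k, (d2 k)%:Z <= rs_m x + 1
      & exists b3 (d3 : 'I_b3 -> nat) (h : 'M[S]_(b3, b2)),
        [/\ graded d3 d2 h, exact_mx h g, minimal_mx h
          & lin_res (rs_m x + 1 + 1) d3 h]]}.
Proof.
apply: cid; have [b2 [d2 [g [gr ex mi lr]]]] := rs_res x.
have [b2' [s [[b3 [d3 [h [h1 h2 h3 h4 h5]]]] span]]] := lin_res_min lr.
exists (Tagged (fun b => ('I_b -> nat) * 'M[S]_(b, rs_b x))%type (d2 \o s, rowsub s g)).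
split=> //=; last by exists b3, d3, h.
- by move=> k l a; rewrite mxE; apply: gr.
- move=> u; rewrite ex; split=> -[v ->]; first exact: span.
  by exists (v *m rowsub s 1%:M); rewrite -mulmxA mul_rowsub_mx mul1mx.
- by move=> k l; rewrite mxE.
Qed.

Definition res_succ (x : res_state) : res_state :=
  let y := res_next x in
  @ResState (rs_m x + 1) (rs_b x) (tag (sval y)) (tagged (sval y)).1
    (tagged (sval y)).2 (let: And5 _ _ _ h _ := svalP y in h)
    (let: And5 _ _ _ _ h := svalP y in h).

Definition res_map (x : res_state) : 'M[S]_(rs_b (res_succ x), rs_b x) :=
  (tagged (sval (res_next x))).2.

Lemma res_map_graded x : graded (@rs_d (res_succ x)) (@rs_d x) (res_map x).
Proof. by case: (svalP (res_next x)). Qed.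

Lemma res_map_minimal x : minimal_mx (res_map x).
Proof. by case: (svalP (res_next x)). Qed.

Lemma res_map_exact0 x : exact_mx (res_map x) (rs_phi x).
Proof. by case: (svalP (res_next x)). Qed.

Lemma res_map_exact x : exact_mx (res_map (res_succ x)) (res_map x).
Proof. exact: (@res_map_exact0 (res_succ x)). Qed.

End MinimalResolution.

(** * Regularity *)

Section RegularityBound.
Variables (K : fieldType) (n : nat).
Local Notation S := {mpoly K[n.+1]}.
Local Notation M := 'X_{1..n.+1}.

Lemma graded_homog b1 b0 (d1 : 'I_b1 -> nat) (d0 : 'I_b0 -> nat)
    (f : 'M[S]_(b1, b0)) k l : graded d1 d0 f ->
  f k l = 0 \/ (d0 l <= d1 k)%N /\ f k l \is (d1 k - d0 l).-homog.
Proof.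
move=> gr; have [->|nz] := eqVneq (f k l) 0; [by left|right].
have h a : a \in msupp (f k l) -> (mdeg a + d0 l = d1 k)%N.
  by rewrite mcoeff_msupp; apply: gr.
split; first by rewrite -(h _ (mlead_supp nz)) leq_addl.
by apply/dhomogP => a /h <-; rewrite addnK.
Qed.

Lemma lin_res_regular (I : S -> Prop) (m : int) b (d : 'I_b -> nat)
    (f : 'M[S]_(b, 1)) :
  lin_res m d f -> graded d (fun=> 0%N) f ->
  (forall g, I g <-> exists u : 'rV_b, (u *m f) 0 0 = g) -> is_regular I m.
Proof.
move=> /lin_res_min [b' [s [[b2 [d2 [g [hd gr ex mi lr]]]] span]]] grf If.
pose x0 := ResState hd (ex_intro _ b2 (ex_intro _ d2 (ex_intro _ g
  (And4 gr ex mi lr)))).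
pose x i := iter i (@res_succ K n.+1) x0.
exists (fun i => rs_b (x i)), (fun i => @rs_d _ _ (x i)), (rs_phi x0),
  (fun i => res_map (x i)).
split; last first.
  have hm i : rs_m (x i) = m + i%:Z.
    elim: i => [|i IH]; first by rewrite addr0.
    by rewrite intS addrCA addrC -IH.
  by move=> i k; rewrite -hm; apply: rs_bound.
split.
- move=> k /=; have h : graded (d \o s) (fun=> 0%N) (rowsub s f).
    by move=> i j a; rewrite mxE; apply: grf.
  case: (graded_homog k 0 h) => [->|[_]]; last by rewrite subn0.
  exact: rpred0.
- by move=> i k l; apply/graded_homog/res_map_graded.
- move=> q; rewrite If; split=> -[u <-].
    by have [u' ->] := span u; exists u'.
  by exists (u *m rowsub s 1%:M); rewrite -mulmxA mul_rowsub_mx mul1mx.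
- exact: (@res_map_exact0 _ _ x0).
- move=> i; exact: (@res_map_exact _ _ (x i)).
- move=> i; exact: (@res_map_minimal _ _ (x i)).
Qed.

(* n.+1 for the exponent 0, so that all the variables are multiplicative. *)
Definition min_var (a : M) : nat := find (fun e => e != 0%N) a.

Lemma min_varP (a : M) (i : 'I_n.+1) : (i < min_var a)%N -> a i = 0%N.
Proof. by rewrite (mnm_nth 0%N) => /(before_find 0%N)/negbFE/eqP. Qed.

Lemma leq_min_var (a : M) (s : 'I_n.+1) :
  (forall i : 'I_n.+1, (i < s)%N -> a i = 0%N) -> (s <= min_var a)%N.
Proof.
move=> h; rewrite leqNgt; apply/negP => lt.
have hn : (min_var a < n.+1)%N by apply: ltn_trans (ltn_ord s).
have ha : has (fun e => e != 0%N) a by rewrite has_find size_tuple.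
have := nth_find 0%N ha; rewrite -/(min_var a) -(mnm_nth 0%N a (Ordinal hn)).
by rewrite h.
Qed.

Lemma mcoeff_pihomog d (p : S) a :
  (pihomog mdeg d p)@_a = if mdeg a == d then p@_a else 0.
Proof.
rewrite [p in RHS]mpolyE pihomogE !(raddf_sum (mcoeff _)) /= big_mkcond /=.
case: ifP => ha; last rewrite big1 // => b _.
  apply: eq_bigr => b _; case: ifP => // hb; rewrite mcoeffZ mcoeffX.
  by case: eqP => [ba|]; rewrite ?mulr0 //; rewrite ba ha in hb.
case: ifP => // hb; rewrite mcoeffZ mcoeffX.
by case: eqP => [ba|]; rewrite ?mulr0 //; rewrite -ba hb in ha.
Qed.

(** * Star decomposition and regularity for strongly stable ideals *)

Section StronglyStable.
Variable J : S -> Prop.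
Hypothesis hJ : is_strongly_stable J.

Lemma monomial_ideal_le a b : J 'X_[a] -> (a <= b)%MM -> J 'X_[b].
Proof.
move=> Ja ab; rewrite -(submK ab) mpolyXD.
by case: (monomial_ideal_is_ideal hJ) => _ _; apply.
Qed.

Lemma monomial_ideal_supp f a : J f -> f@_a != 0 -> J 'X_[a].
Proof.
have [T hT] := hJ.1; move=> /hT [s [hs ->]]; rewrite (raddf_sum (mcoeff _)) /= => h.
have [p ps] : exists2 p, p \in s & (p.1 * p.2)@_a != 0.
  apply: contra_notP (negP h) => nex; apply/eqP; rewrite big_seq big1 // => p ps.
  by apply/eqP/negPn/negP => hp; apply: nex; exists p.
have [t Tt ->] := hs _ ps; rewrite mulrC mcoeffXM.
case: ifP => [ta _|]; last by rewrite eqxx.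
by apply: monomial_ideal_le ta; apply/hT/mem_ideal_gen; exists t.
Qed.

(** Some homogeneous generator [gens k 0] has a divisor of [x^a] in its support. This divisor lies
    in [J], so by minimality it is [x^a], whose degree is then that of the generator. *)
Lemma min_gen_degree m a : is_regular J m -> min_gen J a -> (mdeg a)%:Z <= m.
Proof.
move=> [b [d [gens [phi [res hd]]]]] /andP[/asboolP Ja /asboolP amin].
have [hom im _ _ _ _] : is_min_resolution J d gens phi := res.
have /(res_gens_image res)[u uE] := Ja.
have : ((u *m gens) 0 0)@_a != 0 by rewrite uE mcoeffX eqxx oner_eq0.
rewrite mxE (raddf_sum (mcoeff _)) /= => h.
have [k] : exists k, (u 0 k * gens k 0)@_a != 0.
  apply: contra_notP (negP h) => nex; apply/eqP; rewrite big1 // => k _.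
  by apply/eqP/negPn/negP => hp; apply: nex; exists k.
move=> /coefM_neq0[a1 [a2 [aE _ ga2]]].
have Jg : J (gens k 0).
  by apply/(res_gens_image res); exists (delta_mx 0 k); rewrite -rowE mxE.
have a2a : a2 = a.
  by apply: amin; [exact: monomial_ideal_supp Jg ga2|rewrite aE lem_addl].
have /dhomogP/(_ a) := res_gens_homog res k; rewrite mcoeff_msupp -a2a => /(_ ga2) ->.
by have := hd 0%N k; rewrite addr0.
Qed.

(** Induction on the degree. If [x^a] is not a minimal generator, its quotient by its smallest
    variable [x_s] is still in [J], and [x_s] is multiplicative for the generator [c] found there
    because every variable of [c] divides [x^a]. *)
Lemma star_decomposition a : J 'X_[a] ->
  exists c, [/\ min_gen J c, (c <= a)%MM & low_vars (min_var c) (a - c)%MM].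
Proof.
have [N] := ubnP (mdeg a); elim: N a => // N IH a aN Ja.
have [ma|nma] := boolP (min_gen J a).
  exists a; split=> //; first exact: lepm_refl.
  by apply/low_varsP => i _; rewrite mnmBE subnn.
have [b [Jb ba nba]] : exists b, [/\ J 'X_[b], (b <= a)%MM & b <> a].
  apply: contra_notP (negP nma) => h; rewrite /min_gen.
  apply/andP; split; apply/asboolP => // b Jb ba.
  by apply: contrapT => nba; apply: h; exists b.
have [i bai] : exists i, (b i < a i)%N.
  apply: contra_notP nba => h; apply/mnmP => i; apply/eqP.
  rewrite eqn_leq (mnm_lepP ba) leqNgt; apply/negP => hi; apply: h; by exists i.
have ai0 : a i != 0%N by rewrite -lt0n (leq_ltn_trans _ bai).
have Jai : J 'X_[a - U_(i)].
  apply: (monomial_ideal_le Jb); apply/mnm_lepP => j; rewrite mnmBE mnm1E.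
  have := mnm_lepP ba j; case: eqP => [<- _|_]; last by rewrite subn0.
  by rewrite subn1 -ltnS prednK // (leq_ltn_trans _ bai).
case: (@arg_minnP _ i (fun j => a j != 0%N) (fun j => j : nat) ai0) => s as0 smin.
have as1 : (U_(s) <= a)%MM by rewrite lep1mP.
have Jas : J 'X_[a - U_(s)].
  have [<- //|nis] := eqVneq i s.
  have si : (s < i)%N by rewrite ltn_neqAle smin // andbT eq_sym.
  (* Strong stability exchanges [x_s] for [x_i] in [x^a / x_i], giving [x^a / x_s]. *)
  have := hJ.2 _ s i Jai si; rewrite mnmBE mnm1E (negPf nis) subn0 lt0n => /(_ as0).
  congr (J 'X_[_]); apply/mnmP => j; rewrite !mnmDE !mnmBE !mnm1E.
  case: (eqVneq i j) => [<-|_]; last by rewrite subn0 addn0.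
  by rewrite eq_sym (negPf nis) !subn0 subnK // lt0n.
have [|c [mc ca lo]] := IH (a - U_(s))%MM _ Jas.
  by rewrite -ltnS; apply: leq_trans aN; rewrite -{2}(submK as1) mdegD mdeg1 addn1.
have ca' : (c <= a)%MM by apply: lepm_trans ca (lem_subr _ _).
exists c; split=> //.
have -> : (a - c = (a - U_(s) - c) + U_(s))%MM.
  apply/mnmP => j; have := mnm_lepP ca j; have := mnm_lepP as1 j.
  by rewrite mnmDE !mnmBE; lia.
apply: low_varsD => //; apply/low_varsP => j; rewrite mnm1E; case: eqP => // <-.
rewrite ltnNge leq_min_var // => t ts; apply/eqP.
have : (c t <= a t)%N by apply/mnm_lepP.
suff -> : a t = 0%N by rewrite leqn0.
by apply/eqP; apply: contraTT ts => /smin; rewrite -leqNgt.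
Qed.

(** Applying [cone_weight] both ways, either one generator divides the other and minimality
    concludes, or each weight is smaller than the other. *)
Lemma star_unique a c c' : min_gen J c -> min_gen J c' ->
  (c <= a)%MM -> low_vars (min_var c) (a - c)%MM ->
  (c' <= a)%MM -> low_vars (min_var c') (a - c')%MM -> c = c'.
Proof.
move=> /andP[/asboolP Jc /asboolP mc] /andP[/asboolP Jc' /asboolP mc'] ca lo ca' lo'.
have hB x : (mdeg (a - x)%MM < (mdeg a).+1)%N by rewrite ltnS mdegB.
have e : (c + (a - c) = c' + (a - c'))%MM by rewrite addmC submK // addmC submK.
case: (cone_weight e (@min_varP c') lo' (hB _)) => [[h _]|h].
  by apply/esym/mc.
case: (cone_weight (esym e) (@min_varP c) lo (hB _)) => [[h' _]|h'].
  exact/mc'.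
by have := ltn_trans h h'; rewrite ltnn.
Qed.

(** Each minimal generator of [J], minus its expression modulo [I] by terms outside [J], lies in
    [I]; with the cones of the star decomposition these elements form a marked basis, in degrees at
    most [m]. *)
Lemma strongly_stable_regular (I : S -> Prop) (m : int) :
  is_homogeneous_ideal I -> is_basis_mod J I ->
  is_regular J m -> is_regular I m.
Proof.
move=> [Iid Ihom] [Ifree Ispan] Jreg.
have [I0 ID IM] := Iid.
(* Regularity bounds the degrees in [B_J] by [m], so this finite set is all of [B_J]; the absolute
   value turns [m] into a natural number. *)
pose B := [pred x : 'X_{1..n.+1 < `|m|.+1} | min_gen J x].
have Bfull c : min_gen J c -> exists x : 'X_{1..n.+1 < `|m|.+1}, x = c :> M.
  move=> mc; have h : (mdeg c < `|m|.+1)%N.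
    by have := min_gen_degree Jreg mc; lia.
  by exists (BMultinom h).
pose e (j : 'I_#|B|) : M := enum_val j.
have hg (j : 'I_#|B|) : exists g : S, [/\ I ('X_[e j] - g),
    g \is (mdeg (e j)).-homog & {in msupp g, forall a, ~~ term_in J a}].
  have [g0 g0N Ig0] := Ispan 'X_[e j]; set d := mdeg (e j).
  exists (pihomog mdeg d g0); split; last 1 first.
  - move=> a; rewrite !mcoeff_msupp mcoeff_pihomog; case: ifP; rewrite ?eqxx // => _ h.
    by apply: g0N; rewrite mcoeff_msupp.
  - have := Ihom _ d Ig0; rewrite raddfB /= (pihomog_dE (p := 'X_[_])) //.
    by rewrite dhomogX.
  - exact: pihomogP.
case/fin_all_exists: hg => g hg.
pose C : cones n.+1 1 #|B| :=
  Cones (fun=> 0) e (min_var \o e).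
pose f : 'M[S]_(#|B|, 1) := \matrix_(j, _) ('X_[e j] - g j).
pose d1 (j : 'I_#|B|) := mdeg (e j).
have Bmin (j : 'I_#|B|) : min_gen J (e j) := enum_valP j.
have lead l a : in_lead C l a = term_in J a.
  apply/existsP/asboolP => [[j /and3P[_ h _]]|Ja].
    by apply: (monomial_ideal_le _ h); have /andP[/asboolP] := Bmin j.
  have [c [mc ca lo]] := star_decomposition Ja.
  have [x xc] := Bfull _ mc; have xB : x \in B by rewrite inE xc.
  exists (enum_rank_in xB x).
  by rewrite /in_cone /= /e enum_rankK_in // xc ca lo ord1 eqxx.
have gcoef j a : term_in J a -> (g j)@_a = 0.
  move=> Ja; apply/memN_msupp_eq0; apply: contraTN Ja; case: (hg j) => _ _; exact.
have Irow (u : 'rV_#|B|) : I ((u *m f) 0 0).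
  rewrite mxE; elim/big_ind: _ => // j _; apply: IM; rewrite mxE.
  by case: (hg j).
have zero (r : 'rV[S]_1) : I (r 0 0) ->
    (forall a, term_in J a -> (r 0 0)@_a = 0) -> r = 0.
  move=> Ir rJ; apply/rowP => l; rewrite ord1 [RHS]mxE; apply: Ifree => // a.
  by rewrite mcoeff_msupp; apply: contraNN => /rJ ->.
have mb : marked_basis (fun=> 0%N) d1 C f.
  split.
  - by move=> j; rewrite addn0.
  - move=> j l a; rewrite mxE mcoeffB addn0 => /neq0D[].
      by rewrite -mcoeff_msupp => /mem_msuppXP <-.
    rewrite oppr_eq0 -mcoeff_msupp; case: (hg j) => _ /dhomogP h _; exact: h.
  - by move=> j i /min_varP.
  - move=> j j' l a /and3P[_ /= ca lo] /and3P[_ /= ca' lo'].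
    by apply/enum_val_inj/val_inj/(star_unique _ _ ca lo ca' lo'); apply: Bmin.
  - move=> j l a; rewrite lead => /gcoef h.
    by rewrite mxE mcoeffB h subr0 mcoeffX ord1 eqxx eq_sym.
  - move=> u hu; apply: zero (Irow u) _ => a Ja; apply: hu; by rewrite lead.
apply: (lin_res_regular (marked_basis_lin_res mb _) (mb_graded mb)).
  by move=> j; apply: (min_gen_degree Jreg (Bmin j)).
move=> p; split=> [Ip|[u <-] //].
have [q [r [pE _ _ rJ]]] := @nf_exists _ _ _ _ _ _ _ _ mb predT (p%:M : 'rV_1)
  (fun _ _ _ => isT).
exists q; suff r0 : r = 0.
  by move: pE; rewrite r0 addr0 => /(congr1 (fun A : 'rV_1 => A 0 0)); rewrite mxE eqxx.
apply: zero; last by move=> a Ja; apply/eqP; apply: contraTT Ja => /rJ; rewrite lead.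
have -> : r = p%:M - q *m f by rewrite pE addrC addKr.
rewrite mxE [X in I (X + _)]mxE eqxx mulr1n [X in I (_ + X)]mxE.
exact: is_idealB.
Qed.

Lemma reg_le (I : S -> Prop) : is_homogeneous_ideal I -> is_basis_mod J I ->
  (reg I <= reg J)%E.
Proof.
move=> hI bI; apply: (regP J).2 => m hm.
exact/(regP I).1/strongly_stable_regular.
Qed.

End StronglyStable.

End RegularityBound.

(** * Flatness *)

Section FreeIsFlat.
Variables (R : comPzRingType) (M : lmodType R) (B : eqType).
Variables (e : B -> M) (c : B -> M -> R).
Hypothesis cD : forall b x y, c b (x + y) = c b x + c b y.
Hypothesis cZ : forall b a x, c b (a *: x) = a * c b x.
Hypothesis ce : forall b b', c b (e b') = (b == b')%:R.
Hypothesis gen : forall x, exists s : seq (R * B), x = \sum_(p <- s) p.1 *: e p.2.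

Lemma coord_of0 b : c b 0 = 0.
Proof. by rewrite -(scale0r (0 : M)) cZ mul0r. Qed.

Lemma coord_expansion x : exists L : seq B, forall L', uniq L' -> {subset L <= L'} ->
  x = \sum_(b <- L') c b x *: e b.
Proof.
have [s ->] := gen x; exists [seq p.2 | p <- s] => L' uL'.
elim: s => [|[a b] s IH] sL; rewrite ?big_nil ?big_cons.
  by rewrite big1 // => b _; rewrite coord_of0 scale0r.
rewrite {1}IH => [|b' hb']; last by apply: sL; rewrite inE hb' orbT.
have bL : b \in L' by apply: sL; rewrite inE eqxx.
rewrite [RHS](eq_bigr (fun b' => (a * (b' == b)%:R) *: e b' +
  c b' (\sum_(p <- s) p.1 *: e p.2) *: e b')).
  rewrite big_split /=; congr (_ + _).
  rewrite (bigD1_seq b) //= eqxx mulr1 big1 ?addr0 // => b' /negPf ->.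
  by rewrite mulr0 scale0r.
by move=> b' _; rewrite cD cZ ce scalerDl.
Qed.

Lemma expansion_basis (s : seq M) : exists L : seq B, forall L', uniq L' ->
  {subset L <= L'} -> List.Forall (fun x => x = \sum_(b <- L') c b x *: e b) s.
Proof.
elim: s => [|x s [L IH]]; first by exists [::].
have [L1 h1] := coord_expansion x; exists (L1 ++ L) => L' u sL; constructor.
  by apply: h1 => // b hb; apply: sL; rewrite mem_cat hb.
by apply: IH => // b hb; apply: sL; rewrite mem_cat hb orbT.
Qed.

Section Tensor.
Variable N : lmodType R.
Local Notation "s ~ t" := (@tensor_eq R N M s t) (at level 70).

(** The component at [b] when the tensor product is identified with a direct sum of copies of [N]
    indexed by [B]. *)
Definition tensor_coord (s : seq (N * M)) b : N := \sum_(p <- s) c b p.2 *: p.1.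

Lemma tensor_coord_eq s t b : s ~ t -> tensor_coord s b = tensor_coord t b.
Proof.
rewrite /tensor_coord; elim=> {s t} //.
- by move=> s t u _ -> _ ->.
- by move=> s s' t t' _ h _ h'; rewrite !big_cat /= h h'.
- by move=> s t; rewrite !big_cat /= addrC.
- by move=> y; rewrite big_seq1 big_nil scaler0.
- by move=> x x' y; rewrite !big_cons !big_nil /= !addr0 scalerDr.
- by move=> x y y'; rewrite !big_cons !big_nil /= !addr0 cD scalerDl.
- by move=> a x y; rewrite !big_seq1 /= cZ scalerA mulrC.
Qed.

Lemma tensor_sum_r x L (F : B -> M) :
  [:: (x, \sum_(b <- L) F b)] ~ [seq (x, F b) | b <- L].
Proof.
elim: L => [|b L IH] /=.
  rewrite big_nil -(scale0r (0 : M)).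
  apply: TensorTrans (TensorSym (TensorZ 0 x 0)) _.
  by rewrite scale0r; apply: Tensor0.
rewrite big_cons; apply: TensorTrans (TensorDr _ _ _) _.
exact: (TensorCat (TensorRefl [:: (x, F b)]) IH).
Qed.

Lemma tensor_scale_coef (x : N) L (F : B -> R) :
  [seq (x, F b *: e b) | b <- L] ~ [seq (F b *: x, e b) | b <- L].
Proof.
elim: L => [|b L IH] /=; first exact: TensorRefl.
exact: (TensorCat (TensorSym (TensorZ _ _ _)) IH).
Qed.

Lemma tensor_merge L (f g : B -> N) :
  [seq (f b, e b) | b <- L] ++ [seq (g b, e b) | b <- L] ~
  [seq (f b + g b, e b) | b <- L].
Proof.
elim: L => [|b L IH] /=; first exact: TensorRefl.
set F := map _ _ in IH *; set G := map _ _ in IH *.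
have h : F ++ (g b, e b) :: G ~ (g b, e b) :: F ++ G.
  rewrite -cat_rcons -cats1 -cat_cons.
  exact: TensorCat (TensorC _ [:: _]) (TensorRefl _).
apply: TensorTrans (TensorCat (TensorRefl [:: (f b, e b)]) h) _.
exact: (TensorCat (TensorSym (TensorDl (f b) (g b) (e b))) IH).
Qed.

Lemma tensor_expansion L (s : seq (N * M)) :
  List.Forall (fun x => x = \sum_(b <- L) c b x *: e b) (unzip2 s) ->
  s ~ [seq (tensor_coord s b, e b) | b <- L].
Proof.
rewrite /tensor_coord; elim: s => [|[x y] s IH] /= hs.
  apply: TensorSym; elim: L {hs} => [|b L IH] /=; first exact: TensorRefl.
  by rewrite big_nil; exact (TensorCat (Tensor0 N (e b)) IH).
have /List.Forall_cons_iff[hy {}hs] := hs.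
under eq_map do rewrite big_cons /=.
apply: TensorTrans (tensor_merge _ _ _).
apply: TensorTrans (TensorCat (TensorRefl [:: (x, y)]) (IH hs)) _.
apply: TensorCat (TensorRefl _).
rewrite hy; apply: TensorTrans (tensor_sum_r _ _ _) _.
by rewrite -hy; apply: tensor_scale_coef.
Qed.

End Tensor.

(** In these coordinates [f] acts componentwise, so injectivity is inherited. *)
Lemma free_flat : flat M.
Proof.
move=> N N' f finj s t h.
have [L hL] := expansion_basis (unzip2 s ++ unzip2 t).
have /List.Forall_app[hs ht] : List.Forall _ _ :=
  hL _ (undup_uniq L) (fun b hb => etrans (mem_undup L b) hb).
apply: TensorTrans (tensor_expansion hs) _; apply: TensorSym.
apply: TensorTrans (tensor_expansion ht) _.
suff E b : tensor_coord s b = tensor_coord t b.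
  by under eq_map do rewrite -E; apply: TensorRefl.
apply: finj; have := tensor_coord_eq b h.
rewrite /tensor_coord !big_map !raddf_sum /= => E.
have Z u : \sum_(p <- u) f (c b p.2 *: p.1) = \sum_(p <- u) c b p.2 *: f p.1.
  by apply: eq_bigr => p _; rewrite linearZ.
by rewrite !Z.
Qed.

End FreeIsFlat.

(** * Modules with a basis after localisation at a prime *)

Section LocallyFree.
Variables (A : comNzRingType) (P : A -> Prop) (hP : is_prime_ideal P).
Variables (V : lmodType A) (B : eqType) (e : B -> V) (beta : B -> V -> A).
Local Notation frac := (Defs.frac hP).
Variable delta : B -> denom P.
Hypothesis betaD : forall b x y, beta b (x + y) = beta b x + beta b y.
Hypothesis betaZ : forall b a x, beta b (a *: x) = a * beta b x.
Hypothesis beta_e : forall b b', beta b (e b') = if b == b' then den (delta b) else 0.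
Hypothesis gen : forall v, exists (s : denom P) (l : seq (A * B)),
  den s *: v = \sum_(p <- l) p.1 *: e p.2.

(** [beta b] is the coordinate on [e b] multiplied by [delta b], which becomes a unit; hence the
    extra factor in the denominator. *)
Definition loc_coord b (x : locmod hP V) : locring hP :=
  rfrac hP (beta b (repr x).1) (denomM hP (repr x).2 (delta b)).

Lemma loc_coordE b v s :
  loc_coord b (frac v s) = rfrac hP (beta b v) (denomM hP s (delta b)).
Proof.
rewrite /loc_coord; have [u hu] := frac_repr hP v s.
move: (repr _) hu => [v' s'] /= hu; apply/rfrac_eqP; exists u.
have := congr1 (beta b) hu; rewrite !betaZ !denM => E.
by rewrite !mulrA mulrAC E; ring.
Qed.

Lemma fracDs (v w : V) (s : denom P) : frac (v + w) s = frac v s + frac w s.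
Proof. by rewrite fracD; apply: fracE; rewrite denM -scalerDr scalerA. Qed.

Lemma locally_free_flat : flat_at hP V.
Proof.
apply: (@free_flat _ _ B (fun b => frac (e b) (denom1 hP)) loc_coord).
- move=> b x y; have [v [s ->]] := frac_surj x; have [w [t ->]] := frac_surj y.
  rewrite fracD !loc_coordE rfracD betaD !betaZ; apply: rfracE; rewrite !denM; ring.
- move=> b a x; have [v [s ->]] := frac_surj x; have [r [t ->]] := rfrac_surj a.
  by rewrite fracZ !loc_coordE rfracM betaZ; apply: rfracE; rewrite !denM; ring.
- move=> b b'; rewrite loc_coordE beta_e; case: eqP => _.
    by apply: rfracE; rewrite !denM den1; ring.
  by apply: rfracE; rewrite !mulr0.
- move=> x; have [v [t ->]] := frac_surj x; have [s [l hl]] := gen v.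
  exists [seq (rfrac hP p.1 (denomM hP t s), p.2) | p <- l].
  have -> : frac v t = frac (\sum_(p <- l) p.1 *: e p.2) (denomM hP t s).
    by apply: fracE; rewrite -hl scalerA denM.
  rewrite big_map; elim: {hl} l => [|p l IH].
    by rewrite !big_nil; apply: fracE; rewrite !scaler0.
  rewrite !big_cons -IH fracDs; congr (_ + _); rewrite /= fracZ.
  by apply: fracE; rewrite !denM den1 mulr1.
Qed.

End LocallyFree.

(** * The marked algebra at the origin *)

Section FlatAtOrigin.
Variables (K : fieldType) (n : nat) (J : {mpoly K[n.+1]} -> Prop).
Hypothesis hJ : is_strongly_stable J.
Local Notation M := 'X_{1..n.+1}.
Local Notation A := (marked_ring hJ).
Local Notation proj := (marked_proj hJ).
Local Notation V := (marked_algebra hJ).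
Local Notation vpi := (quotmod_pi (marked_ideal_submodule hJ)).

Lemma marked_poly_coef (a : M) : min_gen J a -> forall b,
  (marked_poly J a)@_b != 0 -> mdeg b = mdeg a.
Proof.
move=> ma b; rewrite mcoeffB => /neq0D[].
  by rewrite -mcoeff_msupp => /mem_msuppXP <-.
rewrite oppr_eq0; apply: contraNeq => nab.
rewrite (raddf_sum (mcoeff _)) big1 //= => g /andP[/eqP ga _].
rewrite mcoeffZ mcoeffX; case: eqP => [gb|]; last by rewrite mulr0.
by rewrite -ga gb eqxx in nab.
Qed.

Definition lead_terms m := [seq a <- terms n m | term_in J a].

Lemma size_lead_terms m : size (lead_terms m) = dim_part J m.
Proof. by rewrite size_filter. Qed.

Lemma lead_termsP m a : (a \in lead_terms m) = term_in J a && (mdeg a == m).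
Proof. by rewrite mem_filter mem_terms. Qed.

(** Selects one row for each term of [J]; at the origin the polynomial of this row is the term
    itself. *)
Lemma row_choice : {r : M -> M * M & forall a, term_in J a ->
  ((r a).1 + (r a).2)%MM = a /\ min_gen J (r a).2}.
Proof.
apply: (@choice _ _ (fun a (r : M * M) => term_in J a ->
  (r.1 + r.2)%MM = a /\ min_gen J r.2)) => a.
have [/asboolP Ja|nJ] := boolP (term_in J a); last by exists (0%MM, 0%MM).
by have [c [mc ca _]] := star_decomposition hJ Ja; exists (a - c, c)%MM => /=;
  rewrite submK.
Qed.

Lemma mem_row_indices m (r : M * M) :
  min_gen J r.2 -> (mdeg r.1 + mdeg r.2 == m)%N -> r \in row_indices J m.
Proof.
case: r => c a /= ma /eqP hm; apply/imageP.
have hc : (mdeg c < m.+1)%N by rewrite ltnS -hm leq_addr.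
have ha : (mdeg a < m.+1)%N by rewrite ltnS -hm leq_addl.
by exists (BMultinom hc, BMultinom ha); rewrite ?inE /= ?ma ?hm ?eqxx.
Qed.

Definition row_of : M -> M * M := projT1 row_choice.

Lemma row_ofP a : term_in J a ->
  ((row_of a).1 + (row_of a).2)%MM = a /\ min_gen J (row_of a).2.
Proof. exact: (projT2 row_choice a). Qed.

Definition row_poly (r : M * M) : {mpoly (KC J)[n.+1]} := 'X_[r.1] * marked_poly J r.2.

Lemma row_poly_coef r b : min_gen J r.2 -> (row_poly r)@_b != 0 ->
  (mdeg b = mdeg r.1 + mdeg r.2)%N.
Proof.
move=> mr; rewrite mcoeffXM; case: ifP => [le|]; last by rewrite eqxx.
by move=> /(marked_poly_coef mr) <-; rewrite -mdegD addmC submK.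
Qed.

Lemma row_poly_eval0 r b :
  KC_eval0 (row_poly r)@_b = ((r.1 + r.2)%MM == b)%:R.
Proof.
rewrite -mcoeff_map_mpoly rmorphM /= map_mpolyX KC_eval0_marked_poly -mpolyXD.
by rewrite mcoeffX.
Qed.

Lemma proj_row_poly r : min_gen J r.2 ->
  vpi (map_mpoly proj (row_poly r)) = 0.
Proof.
move=> mr; rewrite -[RHS](raddf0 vpi); apply/quotmod_pi_eq; rewrite subr0.
rewrite /row_poly rmorphM /=; have [_ _ h] := ideal_gen_is_ideal
  (fun g : {mpoly A[n.+1]} =>
    exists2 a : M, min_gen J a & g = map_mpoly proj (marked_poly J a)).
by apply: h; apply: mem_ideal_gen; exists r.2.
Qed.

Lemma eval0_denom f : KC_eval0 f != 0 -> ~~ `[< origin (proj f) >].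
Proof. by move=> h; apply/asboolPn => /originP/eqP; apply/negP. Qed.

Definition eval0_den f (h : KC_eval0 f != 0) : denom (@origin _ _ _ hJ) :=
  exist (fun a => ~~ `[< origin a >]) (proj f) (eval0_denom h).

Section Coordinate.
Variable b : M.
Hypothesis Jb : ~~ term_in J b.
Local Notation m := (mdeg b).
Local Notation d := (dim_part J (mdeg b)).

(** The index [ord_max] is reserved for the standard term [b]; the other columns are the terms of
    [J_m]. *)
Definition col_term (j : 'I_d.+1) : M :=
  oapp (fun j' : 'I_d => nth 0%MM (lead_terms m) j') b (unlift ord_max j).

Lemma col_term_lead (j : 'I_d) : nth 0%MM (lead_terms m) j \in lead_terms m.
Proof. by rewrite mem_nth // size_lead_terms. Qed.

Lemma col_term_deg j : mdeg (col_term j) = m.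
Proof.
rewrite /col_term; case: unliftP => [j' _|_] //=.
by have := col_term_lead j'; rewrite lead_termsP => /andP[_ /eqP].
Qed.

Lemma col_term_inj : injective col_term.
Proof.
move=> j1 j2; rewrite /col_term.
have hb (j : 'I_d) : nth 0%MM (lead_terms m) j <> b.
  move=> e; have := col_term_lead j; rewrite e lead_termsP => /andP[h _].
  exact: (negP Jb).
case: unliftP => [j1' ->|->]; case: unliftP => [j2' ->|->] //=.
- move/eqP; rewrite nth_uniq ?size_lead_terms ?filter_uniq ?uniq_terms //.
  by move=> /eqP/val_inj ->.
- by move/hb.
- by move/esym/hb.
Qed.

Definition bordered (R : comNzRingType) (rows : 'I_d -> {mpoly R[n.+1]})
    (h : {mpoly R[n.+1]}) : 'M[R]_d.+1 :=
  \matrix_(i, j) (oapp rows h (unlift ord_max i))@_(col_term j).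

Lemma det_bordered_linear (R : comNzRingType) rows (a : R) h h' :
  \det (bordered rows (a *: h + h')) =
    a * \det (bordered rows h) + \det (bordered rows h').
Proof.
rewrite -[\det (bordered rows h')]mul1r; apply: (determinant_multilinear (i0 := ord_max)).
- apply/rowP => j; rewrite !mxE unlift_none /= mul1r.
  by rewrite mcoeffD mcoeffZ.
- by apply/matrixP => i j; rewrite !mxE !liftK.
- by apply/matrixP => i j; rewrite !mxE !liftK.
Qed.

Lemma det_bordered0 (R : comNzRingType) rows (h : {mpoly R[n.+1]}) :
  (forall j, h@_(col_term j) = 0) -> \det (bordered rows h) = 0.
Proof.
move=> h0; rewrite (expand_det_row _ ord_max) big1 // => j _.
by rewrite mxE unlift_none /= h0 mul0r.
Qed.

Definition lead_row (i : 'I_d) := row_of (nth 0%MM (lead_terms m) i).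

Lemma lead_rowP i : ((lead_row i).1 + (lead_row i).2)%MM = nth 0%MM (lead_terms m) i
  /\ min_gen J (lead_row i).2.
Proof.
by apply: row_ofP; have := col_term_lead i; rewrite lead_termsP => /andP[].
Qed.

Definition KC_rows (i : 'I_d) := row_poly (lead_row i).
Definition A_rows (i : 'I_d) := map_mpoly proj (KC_rows i).

Lemma map_bordered h :
  bordered A_rows (map_mpoly proj h) = map_mx proj (bordered KC_rows h).
Proof.
apply/matrixP => i j; rewrite !mxE; case: unlift => [i'|] /=;
  by rewrite mcoeff_map_mpoly.
Qed.

(** As in Cramer's rule, this becomes a unit multiple of the coordinate on [x^b] after
    localisation. *)
Definition coord0 (h : {mpoly A[n.+1]}) : A := \det (bordered A_rows h).

Lemma coord0_linear a h h' : coord0 (a *: h + h') = a * coord0 h + coord0 h'.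
Proof. exact: det_bordered_linear. Qed.

Lemma coord0_0 : coord0 0 = 0.
Proof. by apply: det_bordered0 => j; rewrite mcoeff0. Qed.

(** In degree [m] the bordered matrix comes from a submatrix of [marked_mx] of order
    [dim_part J m + 1], whose determinant generates part of the minors ideal; in other degrees the
    last row is zero. *)
Lemma coord0_row r : min_gen J r.2 -> coord0 (map_mpoly proj (row_poly r)) = 0.
Proof.
move=> mr; have [hm|nm] := eqVneq (mdeg r.1 + mdeg r.2)%N m; last first.
  apply: det_bordered0 => j; rewrite mcoeff_map_mpoly.
  have [->|/(row_poly_coef mr)] := eqVneq (row_poly r)@_(col_term j) 0.
    exact: rmorph0.
  by rewrite col_term_deg => e; rewrite e eqxx in nm.
rewrite /coord0 map_bordered det_map_mx -[RHS](rmorph0 proj).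
apply/quotring_pi_eq; rewrite subr0; apply: mem_ideal_gen.
pose rr i := oapp lead_row r (unlift ord_max i).
have rrP i : rr i \in row_indices J m.
  rewrite /rr; case: unliftP => [i' _|_] /=; last by apply: mem_row_indices; rewrite ?hm.
  have [e mi] := lead_rowP i'; apply: mem_row_indices => //.
  rewrite -mdegD e; have := col_term_lead i'; by rewrite lead_termsP => /andP[].
have ctP j : col_term j \in terms n m by rewrite mem_terms col_term_deg.
have fP i : (index (rr i) (row_indices J m) < size (row_indices J m))%N.
  by rewrite index_mem.
have gP j : (index (col_term j) (terms n m) < size (terms n m))%N by rewrite index_mem.
exists m, (fun i => Ordinal (fP i)), (fun j => Ordinal (gP j)).
congr (\det _); apply/matrixP => i j; rewrite !mxE /= !nth_index //.
by rewrite /rr; case: unlift.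
Qed.

Lemma coord0_ideal h : marked_ideal h -> coord0 h = 0.
Proof.
(* As [coord0] is linear over the coefficients only, all multiples by terms are treated at once. *)
move=> hh; suff Q c : coord0 ('X_[c] * h) = 0 by rewrite -[h]mul1r -mpolyX0.
move: h hh c; apply: ideal_gen_min; last first.
  move=> g [a ma ->] c; rewrite -(map_mpolyX proj c) -rmorphM /=.
  exact: (@coord0_row (c, a)).
split=> [c|x y hx hy c|p x hx c].
- by rewrite mulr0 coord0_0.
- by rewrite mulrDr -[_ * x]scale1r coord0_linear hx hy mulr0 addr0.
- rewrite [p]mpolyE mulr_suml mulr_sumr; elim: (msupp p) => [|a s IH].
    by rewrite big_nil coord0_0.
  rewrite big_cons -scalerAl -scalerAr mulrA -mpolyXD coord0_linear hx IH.
  by rewrite mulr0 addr0.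
Qed.

Definition coord (v : V) : A := coord0 (repr v).

Lemma coordE h : coord (vpi h) = coord0 h.
Proof.
have /quotmod_pi_eq/coord0_ideal E : vpi (repr (vpi h)) = vpi h.
  by rewrite /quotmod_pi reprK.
rewrite /coord -(subrK h (repr _)) -[X in X + h]scale1r coord0_linear E.
by rewrite mulr0 add0r.
Qed.

Lemma coord_linear a x y : coord (a *: x + y) = a * coord x + coord y.
Proof.
have [h ->] := quotmod_pi_surj x; have [h' ->] := quotmod_pi_surj y.
by rewrite -linearZ -raddfD !coordE coord0_linear.
Qed.

Lemma coord_neq c : ~~ term_in J c -> c != b -> coord (vpi 'X_[c]) = 0.
Proof.
move=> Jc cb; rewrite coordE; apply: det_bordered0 => j.
rewrite mcoeffX; case: eqP => // cj; rewrite /col_term in cj.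
move: cj; case: unliftP => [j' _|_] /= cj; last by rewrite cj eqxx in cb.
have := col_term_lead j'; rewrite -cj lead_termsP => /andP[h _].
by rewrite h in Jc.
Qed.

(** At the origin the matrix becomes the identity. *)
Lemma bordered_eval0 : KC_eval0 (\det (bordered KC_rows 'X_[b])) != 0.
Proof.
rewrite -det_map_mx (_ : map_mx _ _ = 1%:M) ?det1 ?oner_eq0 //.
have h i j : (map_mx (@KC_eval0 K n J) (bordered KC_rows 'X_[b])) i j =
    (col_term i == col_term j)%:R.
  rewrite !mxE [in RHS]/col_term; case: (unlift ord_max i) => [i'|] /=.
    by rewrite row_poly_eval0; have [-> _] := lead_rowP i'.
  by rewrite mcoeffX; case: eqP; rewrite ?rmorph1 ?rmorph0.
by apply/matrixP => i j; rewrite h mxE (inj_eq col_term_inj).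
Qed.

Lemma coord_self : coord (vpi 'X_[b]) = den (eval0_den bordered_eval0).
Proof.
by rewrite coordE /coord0 -(map_mpolyX proj) map_bordered det_map_mx.
Qed.

End Coordinate.

Lemma homog_terms (R : comNzRingType) (h : {mpoly R[n.+1]}) m :
  (forall c, h@_c != 0 -> mdeg c = m) ->
  h = \sum_(c <- terms n m) h@_c *: 'X_[c].
Proof.
move=> hm; apply/mpolyP => k; rewrite (raddf_sum (mcoeff _)) /=.
have [km|km] := boolP (k \in terms n m).
  rewrite (bigD1_seq k) ?uniq_terms //= mcoeffZ mcoeffX eqxx mulr1 big1 ?addr0 //.
  by move=> c /negPf ck; rewrite mcoeffZ mcoeffX ck mulr0.
rewrite big_seq big1 => [|c cm]; last first.
  by rewrite mcoeffZ mcoeffX; case: eqP => [ck|]; rewrite ?mulr0 // -ck cm in km *.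
by apply/eqP; apply: contraNT km => /hm km; rewrite mem_terms km.
Qed.

Definition std_term := {b : M | ~~ term_in J b}.
HB.instance Definition _ := Equality.on std_term.

Definition std_vec (b : std_term) : V := vpi 'X_[sval b].

Definition in_span (v : V) : Prop :=
  exists l : seq (A * std_term), v = \sum_(p <- l) p.1 *: std_vec p.2.

Lemma in_span0 : in_span 0.
Proof. by exists [::]; rewrite big_nil. Qed.

Lemma in_spanD v w : in_span v -> in_span w -> in_span (v + w).
Proof. by move=> [l ->] [l' ->]; exists (l ++ l'); rewrite big_cat. Qed.

Lemma in_spanZ a v : in_span v -> in_span (a *: v).
Proof.
move=> [l ->]; exists [seq (a * p.1, p.2) | p <- l].
by rewrite big_map scaler_sumr; apply: eq_bigr => p _; rewrite scalerA.
Qed.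

Lemma in_span_term c : ~~ term_in J c -> in_span (vpi 'X_[c]).
Proof.
by move=> Jc; exists [:: (1, exist _ c Jc)]; rewrite big_seq1 scale1r.
Qed.

Section LeadTermsInSpan.
Variable m : nat.
Local Notation t := (fun j : nat => nth 0%MM (lead_terms m) j).

Definition lead_mx : 'M[KC J]_(size (lead_terms m)) :=
  \matrix_(i, j) (row_poly (row_of (t i)))@_(t j).

Lemma lead_nth (i : 'I_(size (lead_terms m))) : term_in J (t i) /\ mdeg (t i) = m.
Proof.
by have := mem_nth 0%MM (ltn_ord i); rewrite lead_termsP => /andP[-> /eqP].
Qed.

Lemma lead_mx_eval0 : KC_eval0 (\det lead_mx) != 0.
Proof.
rewrite -det_map_mx (_ : map_mx _ _ = 1%:M) ?det1 ?oner_eq0 //.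
apply/matrixP => i j; rewrite !mxE /= row_poly_eval0.
have [-> _] := row_ofP (lead_nth i).1.
by rewrite nth_uniq ?filter_uniq ?uniq_terms.
Qed.

(** The selected row is zero in the quotient, so its part on terms of [J] is the opposite of its
    part on standard terms. *)
Lemma lead_row_span i :
  in_span (\sum_j proj (lead_mx i j) *: vpi 'X_[t j]).
Proof.
have [Jt dt] := lead_nth i; have [rE mr] := row_ofP Jt.
set r := row_of (t i) in rE mr; have := proj_row_poly mr.
have hm c : (map_mpoly proj (row_poly r))@_c != 0 -> mdeg c = m.
  rewrite mcoeff_map_mpoly => h; rewrite (@row_poly_coef r c) // -?mdegD ?rE //.
  by apply: contraNN h => /eqP ->; rewrite raddf0.
rewrite (homog_terms hm) raddf_sum /= (bigID (term_in J)) /= -big_filter.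
rewrite (big_nth 0%MM) big_mkord => /eqP; rewrite addr_eq0 => /eqP E.
have -> : \sum_j proj (lead_mx i j) *: vpi 'X_[t j] =
    \sum_(j < size (lead_terms m)) vpi ((map_mpoly proj (row_poly r))@_(t j) *: 'X_[t j]).
  by apply: eq_bigr => j _; rewrite linearZ mxE mcoeff_map_mpoly.
rewrite E -scaleN1r; apply: in_spanZ; elim/big_ind: _.
- exact: in_span0.
- exact: in_spanD.
- by move=> c Jc; rewrite linearZ; apply/in_spanZ/in_span_term.
Qed.

(** Combining the selected rows with the adjugate isolates a single term of [J], with the
    determinant as coefficient. *)
Lemma lead_span (k : 'I_(size (lead_terms m))) :
  in_span (proj (\det lead_mx) *: vpi 'X_[t k]).
Proof.
have -> : proj (\det lead_mx) *: vpi 'X_[t k] =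
    \sum_i proj (\adj lead_mx k i) *: \sum_j proj (lead_mx i j) *: vpi 'X_[t j].
  under eq_bigr do rewrite scaler_sumr.
  rewrite exchange_big /= (bigD1 k) //= [X in _ + X]big1 ?addr0 => [|j jk].
    under eq_bigr do rewrite scalerA -rmorphM; rewrite -scaler_suml -rmorph_sum /=.
    by have /matrixP/(_ k k) := mul_adj_mx lead_mx; rewrite !mxE eqxx mulr1n => ->.
  under eq_bigr do rewrite scalerA -rmorphM; rewrite -scaler_suml -rmorph_sum /=.
  have /matrixP/(_ k j) := mul_adj_mx lead_mx.
  rewrite !mxE eq_sym (negPf jk) mulr0n => ->.
  by rewrite rmorph0 scale0r.
elim/big_ind: _; [exact: in_span0|exact: in_spanD|].
by move=> i _; apply/in_spanZ/lead_row_span.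
Qed.

End LeadTermsInSpan.

Lemma local_span v :
  exists s : denom (@origin _ _ _ hJ), in_span (den s *: v).
Proof.
have [h ->] := quotmod_pi_surj v; rewrite [h]mpolyE raddf_sum /=.
elim: (msupp h) => [|c s [u hu]].
  by exists (denom1 (origin_prime hJ)); rewrite big_nil scaler0; apply: in_span0.
have [w hw] : exists w : denom (@origin _ _ _ hJ), in_span (den w *: vpi 'X_[c]).
  have [Jc|Jc] := boolP (term_in J c); last first.
    by exists (denom1 (origin_prime hJ)); apply/in_spanZ/in_span_term.
  exists (eval0_den (lead_mx_eval0 (mdeg c))).
  have hi : (index c (lead_terms (mdeg c)) < size (lead_terms (mdeg c)))%N.
    by rewrite index_mem lead_termsP Jc eqxx.
  by have := lead_span (Ordinal hi); rewrite /= nth_index // -index_mem.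
exists (denomM (origin_prime hJ) w u); rewrite denM big_cons scalerDr linearZ /=.
apply: in_spanD; last by rewrite -scalerA; apply: in_spanZ.
rewrite scalerA (_ : _ * _ = den u * h@_c * den w); last by ring.
by rewrite -scalerA; apply: in_spanZ.
Qed.

Lemma flat_at_origin : flat_at (origin_prime hJ) (marked_algebra hJ).
Proof.
apply: (@locally_free_flat _ _ _ _ std_term std_vec (fun b => coord (sval b))
  (fun b => eval0_den (bordered_eval0 (svalP b)))).
- by move=> b x y; rewrite -[x]scale1r coord_linear mul1r scale1r.
- move=> b a x; rewrite -[a *: x]addr0 coord_linear.
  suff -> : coord (sval b) 0 = 0 by rewrite addr0.
  by rewrite -(raddf0 vpi) coordE coord0_0.
- move=> b b'; case: eqP => [<-|bb']; first exact: coord_self.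
  apply: (coord_neq (svalP b')); apply: contra_notN bb' => /eqP h.
  exact/esym/val_inj.
- by move=> v; have [s [l hl]] := local_span v; exists s, l.
Qed.

End FlatAtOrigin.

Theorem proposition4p6 (K : fieldType) (n : nat)
    (J : {mpoly K[n.+1]} -> Prop) (hJ : is_strongly_stable J) :
  flat_at (origin_prime hJ) (marked_algebra hJ) /\
  (forall I : {mpoly K[n.+1]} -> Prop,
     is_homogeneous_ideal I -> is_basis_mod J I -> (reg I <= reg J)%E).
Proof. by split; [exact: flat_at_origin|move=> I; exact: reg_le]. Qed.
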